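(* Let $n\ge 1$ and $k\ge 1$ be integers, let $I=[a,b]$ with $a<b$, and let $\lambda_1,\dots,\lambda_k>0$ be the fixed weights entering the energy functional $E$. For $c_1,c_2\in C^k(I,\mathbb{R}^n)$ put $$d(c_1,c_2)=\inf_{g\in H^1(I,O(n))}E[g;c_1,c_2],$$ where $$E[g;c_1,c_2]=\frac12\int_I\Big(\|g(s)\cdot j^{1,k}_s c_1-j^{1,k}_s c_2\|_L^2+\|g(s)^{-1}g'(s)\|_{\mathfrak{o}(n)}^2\Big)\,ds .$$ Then $d$ defines a distance function on the space $C^k(I,\mathbb{R}^n)/E(n)$ of curves modulo rigid transformations. That is, $d(c_1,c_2)$ depends only on the classes of $c_1$ and $c_2$ in $C^k(I,\mathbb{R}^n)/E(n)$, and the induced function on the quotient is non-negative, symmetric, vanishes at a pair of classes if and only if the two classes are equal, and satisfies the triangle inequality.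
   Context: $O(n)$ is the orthogonal group of real $n\times n$ matrices and $\mathfrak{o}(n)$ is its Lie algebra of antisymmetric matrices, with inner product $\langle\Omega,\Omega'\rangle_{\mathfrak{o}(n)}=\operatorname{tr}(\Omega^T\Omega')=-\operatorname{tr}(\Omega\Omega')$ and induced norm $\|\cdot\|_{\mathfrak{o}(n)}$. $E(n)=O(n)\ltimes\mathbb{R}^n$ is the Euclidean group, acting on curves pointwise by $((g,x)\cdot c)(s)=g\,c(s)+x$. The quotient $C^k(I,\mathbb{R}^n)/E(n)$ is the set of orbits of this action. (The symbol $E$ with square brackets denotes the energy functional.) For $c\in C^k(I,\mathbb{R}^n)$ and $s\in I$, $j^{1,k}_s c$ is the $n\times k$ matrix whose $i$-th column is the $i$-th derivative $c^{(i)}(s)$, $i=1,\dots,k$. The group $O(n)$ acts on $n\times k$ matrices by left multiplication, $g\cdot A=gA$. On the space of $n\times k$ matrices, $\langle A,B\rangle_L=\operatorname{tr}(LA^TB)=\sum_{i=1}^k\lambda_i\langle a^{(i)},b^{(i)}\rangle$, where $L=\operatorname{diag}(\lambda_1,\dots,\lambda_k)$, and $a^{(i)},b^{(i)}$ are the $i$-th columns of $A,B$; $\|\cdot\|_L$ is the induced norm. $H^1(I,O(n))$ is the space of continuous curves $g:I\to O(n)$ that are of Sobolev class $H^1$ in charts of $O(n)$; equivalently, absolutely continuous curves with square-integrable derivative when $O(n)$ is viewed inside the space of $n\times n$ matrices.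
   Formalization: The triangle inequality is proved for the square root of d instead of d itself, because it fails for d (for c_i(s)=i s e_1, d(c_0,c_2)=4m while d(c_0,c_1) and d(c_1,c_2) are at most m=λ_1(b-a)/2); all other claims are for d as defined. *)

(* Defs.v *)
From HB Require Import structures.
From mathcomp Require Import all_boot all_order all_algebra.
From mathcomp Require Import all_classical all_reals all_analysis.
Set Implicit Arguments.
Unset Strict Implicit.
Unset Printing Implicit Defensive.
Import Order.TTheory GRing.Theory Num.Theory.
Import numFieldNormedType.Exports.
Local Open Scope classical_set_scope.
Local Open Scope ring_scope.

(** Curves on [[a, b]] are total functions on [R]; only their values on
    [[a, b]] are ever used. *)

Section IntervalCalculus.
Context {R : realType} {V : normedModType R} (a b : R).

(* [t] tends to [s] inside [[a, b]], so derivatives at [a] and [b] are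
   one-sided. *)
Definition is_deriv_on (f : R -> V) (s : R) (l : V) : Prop :=
  (fun t => (t - s)^-1 *: (f t - f s)) @ within `[a, b] s^' --> l.

Definition deriv_on (f : R -> V) (s : R) : V :=
  lim ((fun t => (t - s)^-1 *: (f t - f s)) @ within `[a, b] s^').

Definition nth_deriv_on (i : nat) (f : R -> V) : R -> V := iter i deriv_on f.

(* Continuity of the derivatives of order [< k] follows from their
   differentiability. *)
Definition Ck (k : nat) : set (R -> V) :=
  [set c | (forall i s, (i < k)%N -> s \in `[a, b] ->
              is_deriv_on (nth_deriv_on i c) s (nth_deriv_on i.+1 c s))
           /\ {within `[a, b], continuous (nth_deriv_on k c)}].

Definition abs_continuous_on (f : R -> V) : Prop :=
  forall e : R, 0 < e -> exists2 d : R, 0 < d &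
    forall (m : nat) (x y : 'I_m -> R),
      (forall i, [/\ a <= x i, x i <= y i & y i <= b]) ->
      trivIset setT (fun i => [set` `]x i, y i[]) ->
      \sum_(i < m) (y i - x i) < d ->
      \sum_(i < m) `|f (y i) - f (x i)| < e.

End IntervalCalculus.

Definition orthogonal_group {R : realType} {n : nat} : set 'M[R]_n :=
  [set g | g^T *m g = 1%:M].

(* The class of [c] in C^k([a, b], R^n) / E(n). *)
Definition euclidean_orbit {R : realType} {n : nat} (a b : R) (k : nat)
    (c : R -> 'cV[R]_n) : set (R -> 'cV[R]_n) :=
  [set c' | Ck a b k c' /\
     exists2 g : 'M[R]_n, orthogonal_group g &
     exists x : 'cV[R]_n, {in `[a, b], forall s, c' s = g *m c s + x}].

Definition curves_mod_euclidean {R : realType} {n : nat} (a b : R) (k : nat) :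
    set (set (R -> 'cV[R]_n)) :=
  euclidean_orbit a b k @` Ck a b k.

Definition jet {R : realType} {n : nat} (a b : R) (k : nat)
    (c : R -> 'cV[R]_n) (s : R) : 'M[R]_(n, k) :=
  \matrix_(i < n, j < k) nth_deriv_on a b j.+1 c s i ord0.

Definition inner_L {R : realType} {n k : nat} (lam : 'rV[R]_k)
    (A B : 'M[R]_(n, k)) : R := \tr (diag_mx lam *m A^T *m B).

Definition norm_L {R : realType} {n k : nat} (lam : 'rV[R]_k)
    (A : 'M[R]_(n, k)) : R := Num.sqrt (inner_L lam A A).

Definition inner_o {R : realType} {n : nat} (W W' : 'M[R]_n) : R :=
  \tr (W^T *m W').

Definition norm_o {R : realType} {n : nat} (W : 'M[R]_n) : R :=
  Num.sqrt (inner_o W W).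

(* [H1_curve a b g dg]: on [[a, b]], [g] is an H^1 curve in O(n) and [dg]
   represents the class of its derivative in L^2, which is defined only almost
   everywhere. *)
Definition H1_curve {R : realType} {n : nat} (a b : R)
    (g dg : R -> 'M[R]_n) : Prop :=
  [/\ {in `[a, b], forall s, orthogonal_group (g s)},
      abs_continuous_on a b g,
      {ae (@lebesgue_measure R), forall s, s \in `[a, b] ->
         is_deriv_on a b g s (dg s)} &
      forall i j,
        measurable_fun `[a, b] (fun s => dg s i j) /\
        (@lebesgue_measure R).-integrable `[a, b]
          (fun s => (dg s i j ^+ 2)%:E)].

Definition energy {R : realType} {n k : nat} (a b : R) (lam : 'rV[R]_k)
    (c1 c2 : R -> 'cV[R]_n) (g dg : R -> 'M[R]_n) : \bar R :=
  ((2^-1)%:E * \int[@lebesgue_measure R]_(s in `[a, b])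
     (norm_L lam (g s *m jet a b k c1 s - jet a b k c2 s) ^+ 2
      + norm_o (invmx (g s) *m dg s) ^+ 2)%:E)%E.

(* The infimum of a quadratic energy behaves like a squared length: it is its
   square root that satisfies the triangle inequality.  [min_energy] itself
   never does: for c_i(s) = i s e_1 (i = 0, 1, 2) and m = lam_1 (b - a) / 2, it
   is at most m between c_0 and c_1 and between c_1 and c_2, but equals 4 m
   between c_0 and c_2. *)
Definition min_energy {R : realType} {n k : nat} (a b : R) (lam : 'rV[R]_k)
    (c1 c2 : R -> 'cV[R]_n) : \bar R :=
  ereal_inf [set e | exists g dg : R -> 'M[R]_n,
    H1_curve a b g dg /\ e = energy a b lam c1 c2 g dg].

(* Main.v *)
Require Import Defs.
From HB Require Import structures.
From mathcomp Require Import all_boot all_order all_algebra.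
From mathcomp Require Import all_classical all_reals all_analysis.
From mathcomp Require Import measurable_realfun.
From mathcomp Require Import ring lra.
Set Implicit Arguments.
Unset Strict Implicit.
Unset Printing Implicit Defensive.
Import Order.TTheory GRing.Theory Num.Theory.
Import numFieldNormedType.Exports.
Local Open Scope classical_set_scope.
Local Open Scope ring_scope.

(** Write [D] for [min_energy] and [J c] for the jet of [c].
    Everything is proved for the quadratic quantity [D] itself; square roots are
    taken only at the end.

    Triangle inequality.  If [g1] carries [c1] towards [c2] and [g2] carries [c2]
    towards [c3], then [g2 g1] carries [c1] towards [c3], because
    [g2 g1 J c1 - J c3 = g2 (g1 J c1 - J c2) + (g2 J c2 - J c3)] and
    [(g2 g1)' = g2' g1 + g2 g1'].  Left multiplication by an orthogonal matrix
    preserves both norms and right multiplication preserves the Frobenius norm,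
    so the pointwise Young inequality [weighted_sq_young] gives
    [D c1 c3 <= (1 + t) D c1 c2 + (1 + 1/t) D c2 c3] for every [t > 0]
    ([min_energy_young]).  Optimising over [t] is exactly the triangle inequality
    for the square root of [D] ([sqrt_triangle_of_young]).

    Symmetry holds since [g] and its transpose have equal energy.  A rigid motion
    [c' = h c + x] has [J c' = h J c], so the constant curve [h] has energy zero
    and [D c c' = 0]; together with the triangle inequality this makes [D]
    constant on pairs of orbits ([min_energy_orbit]).

    Definiteness is the analytic part.  If [D c1 c2 = 0], choose [g] of energy at
    most [e^2].  Then [g'] is small in [L^2], hence in [L^1], and so [g] stays
    close to the constant [h = g a]: here one needs that an absolutely continuous
    function is controlled by the integral of its almost everywhere derivative
    ([abs_continuous_growth]).  Hence [h c1' - c2'] is small in [L^1] and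
    [h (c1 t - c1 a)] is uniformly close to [c2 t - c2 a]
    ([min_energy0_near_rotation]).  Since [O(n)] is compact, the rotations [h]
    cluster as [e] tends to [0], at a rotation with
    [h (c1 t - c1 a) = c2 t - c2 a] ([min_energy0_orbit]).

    The bound [abs_continuous_growth] is obtained by a gauge argument.  Let [F] be
    the indefinite integral of the norm of [f'].  Off a null set both [f] and [F]
    are differentiable with [F' = |f'|], so small intervals around such a point
    satisfy [|f y - f x| <= F y - F x + e (y - x)].  The null set is covered by an
    open set of small measure, where absolute continuity of [f] makes the total
    increment small.  Cousin's lemma ([cousin]) cuts the interval into finitely
    many pieces of these two kinds. *)

(** * Derivatives on a segment *)

Section OneVariable.
Context {R : realType}.
Implicit Types (a b : R).

Lemma cvg_mxP (T : Type) (F : set_system T) (FF : Filter F) (m n : nat)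
    (f : T -> 'M[R]_(m, n)) (l : 'M[R]_(m, n)) :
  (f @ F --> l) <-> (forall i j, (fun t => f t i j) @ F --> l i j).
Proof.
split=> [fl i j|fl].
  exact: (cvg_comp _ _ fl (@coord_continuous R m n i j l)).
apply/cvg_ballP => e e0.
have /filter_forall H : forall i, \forall t \near F, forall j,
  ball (l i j) e (f t i j).
  move=> i; apply: filter_forall => j.
  by have /cvg_ballP /(_ e e0) := fl i j.
by apply: filterS H => t Ht; split.
Qed.

Lemma is_deriv_on_mxP a b m n (f : R -> 'M[R]_(m, n)) s l :
  is_deriv_on a b f s l <->
  (forall i j, is_deriv_on a b (fun t => f t i j) s (l i j)).
Proof.
rewrite /is_deriv_on; split.
  move/cvg_mxP => H i j; have := H i j.
  by under eq_fun do rewrite !mxE.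
move=> H; apply/cvg_mxP => i j; under eq_fun do rewrite !mxE.
exact: H.
Qed.

(** The form in which derivatives are used below: it makes sense at [t = s] too,
    so punctured neighbourhoods disappear from the later arguments. *)
Lemma is_deriv_on_near a b (V : normedModType R) (f : R -> V) s l :
  is_deriv_on a b f s l -> forall e, 0 < e ->
  \forall t \near s, t \in `[a, b] ->
    `|f t - f s - (t - s) *: l| <= e * `|t - s|.
Proof.
move=> /cvgrPdist_le H e /H /=; rewrite near_withinE /dnbhs near_withinE.
apply: filterS => t Ht tab.
have [->|ts] := eqVneq t s; first by rewrite !subrr scale0r subrr !normr0 mulr0.
have {}Ht := Ht ts tab.
have ts0 : t - s != 0 by rewrite subr_eq0.
have -> : f t - f s - (t - s) *: l = - ((t - s) *: (l - (t - s)^-1 *: (f t - f s))).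
  by rewrite scalerBr scalerA divff// scale1r opprB.
by rewrite normrN normrZ mulrC ler_wpM2r.
Qed.

Lemma is_deriv_on_eq a b (V : normedModType R) (f g : R -> V) s l :
  s \in `[a, b] -> {in `[a, b], f =1 g} ->
  is_deriv_on a b f s l -> is_deriv_on a b g s l.
Proof.
move=> sab fg; apply: cvg_trans; apply: near_eq_cvg.
rewrite near_withinE; apply: nearW => t tab.
by rewrite !fg.
Qed.

Lemma within_dnbhs_proper a b s : a < b -> s \in `[a, b] ->
  ProperFilter (within `[a, b] s^').
Proof.
move=> ab; rewrite in_itv/= => /andP[as_ sb].
apply: Build_ProperFilter_ex => P PP.
have /nbhs_ballP[e /= e0 He] : \forall t \near s, t != s -> t \in `[a, b] -> P t.
  exact: PP.
have [m [m0 me mab]] : exists m, [/\ 0 < m, m < e & m <= (b - a) / 2].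
  (* At most half the length of [[a, b]], so that [s + m] or [s - m] stays inside. *)
  exists (Num.min (e / 2) ((b - a) / 2)); split.
  - by rewrite lt_min !divr_gt0// subr_gt0.
  - by rewrite gt_min; apply/orP; left; lra.
  - by rewrite ge_min lexx orbT.
have [slt|sgt] := leP s ((a + b) / 2).
- exists (s + m); apply: (He (s + m)).
  + by rewrite /ball/= opprD addNKr normrN gtr0_norm.
  + by rewrite gt_eqF// ltrDl.
  + by rewrite /= in_itv/=; apply/andP; split; lra.
- exists (s - m); apply: (He (s - m)).
  + by rewrite /ball/= opprB addrC subrK gtr0_norm.
  + by rewrite lt_eqF// gtrDl oppr_lt0.
  + by rewrite /= in_itv/=; apply/andP; split; lra.
Qed.

Lemma deriv_onE a b (V : normedModType R) (f : R -> V) s l :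
  a < b -> s \in `[a, b] -> is_deriv_on a b f s l -> deriv_on a b f s = l.
Proof.
move=> ab sab fl; have FF := within_dnbhs_proper ab sab.
exact: cvg_lim fl.
Qed.

Lemma is_deriv_on_cst a b (V : normedModType R) (x : V) s :
  is_deriv_on a b (fun=> x) s 0.
Proof.
rewrite /is_deriv_on; under eq_fun do rewrite subrr scaler0.
exact: cvg_cst.
Qed.

Lemma is_deriv_onD a b (V : normedModType R) (f g : R -> V) s l m :
  is_deriv_on a b f s l -> is_deriv_on a b g s m ->
  is_deriv_on a b (fun t => f t + g t) s (l + m).
Proof.
move=> fl gm; rewrite /is_deriv_on.
under eq_fun do rewrite opprD addrACA scalerDr.
exact: cvgD fl gm.
Qed.

Lemma is_deriv_on_sum a b (V : normedModType R) (I : Type) (r : seq I)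
    (f : I -> R -> V) s (l : I -> V) :
  (forall i, is_deriv_on a b (f i) s (l i)) ->
  is_deriv_on a b (fun t => \sum_(i <- r) f i t) s (\sum_(i <- r) l i).
Proof.
move=> fl; elim: r => [|i r IH].
  rewrite big_nil; under eq_fun do rewrite big_nil; exact: is_deriv_on_cst.
rewrite big_cons; under eq_fun do rewrite big_cons; exact: is_deriv_onD.
Qed.

Lemma is_deriv_on_continuous a b (V : normedModType R) (f : R -> V) s l :
  is_deriv_on a b f s l -> f @ within `[a, b] (nbhs s) --> f s.
Proof.
move=> fl; apply/cvgrPdist_le => e e0.
have M0 : 0 < 1 + `|l| by rewrite ltr_wpDr.
have H1 := is_deriv_on_near fl ltr01.
have H2 : \forall t \near s, `|s - t| < e / (1 + `|l|).
  by apply/nbhs_ballP; exists (e / (1 + `|l|)) => //=; rewrite divr_gt0.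
rewrite near_withinE; apply: filterS2 H1 H2 => t H1 + tab.
rewrite ltr_pdivlMr// => /ltW; apply: le_trans.
rewrite distrC -[f t - f s](subrK ((t - s) *: l)).
apply: (le_trans (ler_normD _ _)); rewrite normrZ mulrDr mulr1 (distrC s).
by rewrite lerD// (le_trans (H1 tab))// mul1r.
Qed.

Lemma is_deriv_onM a b (f g : R -> R) s l m :
  is_deriv_on a b f s l -> is_deriv_on a b g s m ->
  is_deriv_on a b (fun t => f t * g t) s (l * g s + f s * m).
Proof.
move=> fl gm; rewrite /is_deriv_on.
have gc : g @ within `[a, b] s^' --> g s.
  apply: cvg_trans (is_deriv_on_continuous gm); apply: cvg_app.
  by move=> P; rewrite /within /=; exact: nbhs_dnbhs.
have -> : (fun t => (t - s)^-1 *: (f t * g t - f s * g s)) =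
  (fun t => ((t - s)^-1 *: (f t - f s)) * g t + f s * ((t - s)^-1 *: (g t - g s))).
  by apply/funext => t; rewrite /GRing.scale/=; ring.
apply: cvgD; first exact: cvgM fl gc.
exact: cvgMr gm.
Qed.

Lemma is_deriv_on_mulmx a b m n p (A : R -> 'M[R]_(m, n))
    (B : R -> 'M[R]_(n, p)) s dA dB :
  is_deriv_on a b A s dA -> is_deriv_on a b B s dB ->
  is_deriv_on a b (fun t => A t *m B t) s (dA *m B s + A s *m dB).
Proof.
move=> /is_deriv_on_mxP HA /is_deriv_on_mxP HB; apply/is_deriv_on_mxP => i j.
rewrite !mxE -big_split/=; under eq_fun do rewrite mxE.
by apply: is_deriv_on_sum => k; apply: is_deriv_onM.
Qed.

Lemma is_deriv_on_trmx a b m n (A : R -> 'M[R]_(m, n)) s dA :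
  is_deriv_on a b A s dA -> is_deriv_on a b (fun t => (A t)^T) s dA^T.
Proof.
move=> /is_deriv_on_mxP HA; apply/is_deriv_on_mxP => i j.
by rewrite mxE; under eq_fun do rewrite mxE; exact: HA.
Qed.

(** Iterated derivatives are limits, hence defined even where differentiability
    fails; so the formula and the differentiability of [c'] at order [i] are
    obtained together, each step needing the formula at the previous order on
    the whole interval. *)
Lemma nth_deriv_on_rigid a b k n (c c' : R -> 'cV[R]_n) (g : 'M[R]_n) x :
  a < b -> Ck a b k c -> {in `[a, b], forall s, c' s = g *m c s + x} ->
  forall i, (i < k)%N -> {in `[a, b], forall s,
    nth_deriv_on a b i.+1 c' s = g *m nth_deriv_on a b i.+1 c s /\
    is_deriv_on a b (nth_deriv_on a b i c') s (nth_deriv_on a b i.+1 c' s)}.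
Proof.
move=> ab [cd _] c'E.
have step i f y s : (i < k)%N -> s \in `[a, b] ->
    {in `[a, b], forall t, f t = g *m nth_deriv_on a b i c t + y} ->
    is_deriv_on a b f s (g *m nth_deriv_on a b i.+1 c s).
  move=> ik sab fE.
  apply: (@is_deriv_on_eq _ _ _ (fun t => g *m nth_deriv_on a b i c t + y)) => //.
    by move=> t tab; rewrite fE.
  have := is_deriv_onD (is_deriv_on_mulmx (is_deriv_on_cst a b g s) (cd i s ik sab))
    (is_deriv_on_cst a b y s).
  by rewrite mul0mx add0r addr0.
suff H i : (i < k)%N -> {in `[a, b], forall s,
    is_deriv_on a b (nth_deriv_on a b i c') s (g *m nth_deriv_on a b i.+1 c s)}.
  move=> i ik s sab; have d := H i ik s sab.
  have E : nth_deriv_on a b i.+1 c' s = g *m nth_deriv_on a b i.+1 c s.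
    exact: deriv_onE d.
  by rewrite E.
elim: i => [|i IH] ik s sab; first exact: (step 0%N _ x).
apply: (step i.+1 _ 0) => // t tab; rewrite addr0.
by apply: (deriv_onE ab tab); apply: IH => //; exact: ltnW.
Qed.

Lemma Ck_continuous a b k (V : normedModType R) (c : R -> V) i :
  Ck a b k c -> (i <= k)%N -> {within `[a, b], continuous (nth_deriv_on a b i c)}.
Proof.
move=> [cd ck]; rewrite leq_eqVlt => /predU1P[->//|ik].
apply/subspace_continuousP => s sab.
by apply: is_deriv_on_continuous; apply: cd.
Qed.
End OneVariable.

(** * Growth of absolutely continuous functions *)

(** Cousin's lemma: a property of intervals that is additive and holds for all
    small intervals around each point holds for the whole interval.  The supremum
    of the [x] with [P a x] is reached and cannot be smaller than [b]. *)
Lemma cousin {R : realType} (P : R -> R -> Prop) (a b : R) : a <= b ->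
  (forall x y z, a <= x -> x <= y -> y <= z -> z <= b ->
     P x y -> P y z -> P x z) ->
  (forall s, s \in `[a, b] -> exists2 d : R, 0 < d & forall x y,
     a <= x -> x <= s -> s <= y -> y <= b -> s - x < d -> y - s < d -> P x y) ->
  P a b.
Proof.
move=> ab Ptrans Ploc.
pose S := [set x | a <= x <= b /\ P a x].
have Sa : S a.
  split; first by rewrite lexx.
  have [|d d0 H] := Ploc a; first by rewrite in_itv/= lexx.
  by apply: H => //; rewrite subrr.
have ubS : ubound S b by move=> x [/andP[]].
have supS : has_sup S by split; [exists a|exists b].
have ac : a <= sup S by apply: ub_le_sup => //; exists b.
have cb : sup S <= b by apply: ge_sup => //; exists a.
have [|d d0 H] := Ploc (sup S); first by rewrite in_itv/= ac.
have [x [/andP[ax xb] Pax] xc] := sup_adherent d0 supS.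
have xS : x <= sup S by apply: ub_le_sup => //; [exists b|split => //; rewrite ax].
(* A point beyond the supremum, unless the supremum is [b]. *)
pose y := Num.min b (sup S + d / 2).
have yb : y <= b by rewrite /y ge_min lexx.
have cy : sup S <= y by rewrite /y le_min cb/=; lra.
have Pay : P a y.
  apply: (Ptrans a x y) => //; first exact: le_trans cy.
  apply: H => //; first by lra.
  have yd : y <= sup S + d / 2 by rewrite /y ge_min lexx orbT.
  by lra.
have : y <= sup S.
  by apply: ub_le_sup; [exists b|split => //; rewrite yb (le_trans ac cy)].
rewrite {1}/y ge_min => /orP[bc|]; last by lra.
by have <- : y = b by apply/eqP; rewrite eq_le yb/=; exact: le_trans cy.
Qed.

Section Growth.
Context {R : realType}.
Local Notation mu := (@lebesgue_measure R).

(** The list collects the pieces lying in the exceptional open set [U].  Keeping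
    them sorted makes them disjoint, and bounding their total length by the
    measure of [U] inside the current interval makes the property additive, as
    Cousin's lemma requires. *)
Lemma gauge_sum (f F : R -> R) (U : set R) (a b e : R) : a <= b ->
  0 <= e -> open U -> {homo F : x y / x <= y} ->
  (forall s, s \in `[a, b] -> ~ U s -> \forall t \near s, t \in `[a, b] ->
     `|f t - f s| <= `|F t - F s| + e * `|t - s|) ->
  exists l : seq (R * R),
  [/\ all (fun p => [&& a <= p.1, p.1 <= p.2 & p.2 <= b]) l,
      pairwise (fun p q => p.2 <= q.1) l,
      ((\sum_(p <- l) (p.2 - p.1))%:E <= mu U)%E &
      `|f b - f a| <= F b - F a + e * (b - a)
                      + \sum_(p <- l) `|f p.2 - f p.1|].
Proof.
move=> ab e0 oU Fnd good.
have mI (x y : R) : measurable (U `&` `]x, y]).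
  by apply: measurableI => //; exact: open_measurable.
suff [l [l1 l2 l3 l4]] : exists l : seq (R * R),
    [/\ all (fun p => [&& a <= p.1, p.1 <= p.2 & p.2 <= b]) l,
      pairwise (fun p q => p.2 <= q.1) l,
      ((\sum_(p <- l) (p.2 - p.1))%:E <= mu (U `&` `]a, b]))%E &
      `|f b - f a| <= F b - F a + e * (b - a)
                      + \sum_(p <- l) `|f p.2 - f p.1|].
  exists l; split => //; apply: (le_trans l3); apply: le_measure.
  - by rewrite inE; exact: mI.
  - by rewrite inE; exact: open_measurable.
  - by move=> x [].
apply: (cousin (P := fun x y => exists l : seq (R * R),
    [/\ all (fun p => [&& x <= p.1, p.1 <= p.2 & p.2 <= y]) l,
      pairwise (fun p q => p.2 <= q.1) l,
      ((\sum_(p <- l) (p.2 - p.1))%:E <= mu (U `&` `]x, y]))%E &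
      `|f y - f x| <= F y - F x + e * (y - x)
                      + \sum_(p <- l) `|f p.2 - f p.1|]) ab).
- move=> x y z _ xy yz _ [l [l1 l2 l3 l4]] [m [m1 m2 m3 m4]].
  exists (l ++ m); split.
  + rewrite all_cat; apply/andP; split.
      by apply: sub_all l1 => p /and3P[-> ->]/= /le_trans; apply.
    by apply: sub_all m1 => p /and3P[/(le_trans xy) -> -> ->].
  + rewrite pairwise_cat l2 m2 !andbT; apply/allrelP => p q pl qm.
    have /and3P[_ _ py] := allP l1 _ pl; have /and3P[yq _ _] := allP m1 _ qm.
    exact: le_trans yq.
  + rewrite big_cat/= EFinD.
    have -> : U `&` `]x, z] = (U `&` `]x, y]) `|` (U `&` `]y, z]).
      by rewrite -setIUr -itv_bndbnd_setU.
    rewrite measureU//; [exact: leeD|exact: mI|exact: mI|].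
    apply/seteqP; split => // t [[_ /=]]; rewrite in_itv/= => /andP[_ ty] [_ /=].
    by rewrite in_itv/= ltNge ty.
  + rewrite big_cat/=.
    have -> : f z - f x = (f z - f y) + (f y - f x) by ring.
    by apply: (le_trans (ler_normD _ _)); lra.
- move=> s sab; have [Us|nUs] := pselect (U s).
  + have /nbhs_ballP[d /= d0 dU] : nbhs s U by exact: open_nbhs_nbhs.
    exists d => // x y ax xs sy yb xd yd.
    have xy := le_trans xs sy.
    have sub : `[x, y] `<=` U.
      move=> t /=; rewrite in_itv/= => /andP[xt ty]; apply: dU; rewrite /ball/=.
      by rewrite ltr_norml; apply/andP; split; lra.
    exists [:: (x, y)]; split => //=.
    * by rewrite !lexx xy.
    * rewrite big_seq1/= (_ : U `&` _ = `]x, y]%classic).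
        rewrite /= lebesgue_measure_itv/= lte_fin.
        by case: ltgtP xy => // -> _; rewrite subrr.
      apply/setIidPr; apply: subset_trans sub; exact: subset_itv_oc_cc.
    * by rewrite big_seq1/= lerDr addr_ge0// ?subr_ge0 ?Fnd// mulr_ge0// subr_ge0.
  + have /nbhs_ballP[d /= d0 dH] := good s sab nUs.
    exists d => // x y ax xs sy yb xd yd.
    move: sab; rewrite in_itv/= => /andP[as_ sb].
    exists [::]; split => //; first by rewrite big_nil.
    have H t : a <= t -> t <= b -> `|s - t| < d ->
        `|f t - f s| <= `|F t - F s| + e * `|t - s|.
      by move=> at_ tb std; apply: dH => //; rewrite /= in_itv/= at_.
    have Hx := H x ax (le_trans xs sb) _; have Hy := H y (le_trans as_ sy) yb _.
    rewrite big_nil addr0.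
    have -> : f y - f x = (f y - f s) - (f x - f s) by ring.
    apply: (le_trans (ler_normB _ _)).
    have -> : F y - F x + e * (y - x) =
      (`|F y - F s| + e * `|y - s|) + (`|F x - F s| + e * `|x - s|).
      rewrite (ger0_norm (x := F y - F s)) ?subr_ge0 ?Fnd//.
      rewrite (ler0_norm (x := F x - F s)) ?subr_le0 ?Fnd//.
      rewrite (ger0_norm (x := y - s)) ?subr_ge0//.
      rewrite (ler0_norm (x := x - s)) ?subr_le0//.
      by ring.
    apply: lerD; [apply: Hy|apply: Hx].
      by rewrite distrC ger0_norm// subr_ge0.
    by rewrite ger0_norm// subr_ge0.
Qed.

Lemma derivable_near (F : R -> R) (s : R) : derivable F s 1 ->
  forall e, 0 < e -> \forall t \near s,
    `|F t - F s - (t - s) * derive1 F s| <= e * `|t - s|.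
Proof.
move=> dF e e0.
have /cvgrPdist_le/(_ e e0) :
    h^-1 *: (F (h + s) - F s) @[h --> 0^'] --> derive1 F s.
  rewrite /derive1; move: dF; rewrite /derivable /=.
  by under eq_fun do rewrite /GRing.scale/= mulr1.
rewrite /dnbhs near_withinE => /nbhs_ballP[d /= d0 H].
apply/nbhs_ballP; exists d => //= t; rewrite /ball/= distrC => st.
have [->|ts] := eqVneq t s; first by rewrite !subrr mul0r subrr !normr0 mulr0.
have ts0 : t - s != 0 by rewrite subr_eq0.
have /= := H (t - s); rewrite /ball/= sub0r normrN subrK => /(_ st ts0).
move=> {}H.
have -> : F t - F s - (t - s) * derive1 F s =
    - ((t - s) * (derive1 F s - (t - s)^-1 *: (F t - F s))).
  by rewrite /GRing.scale/= mulrBr mulVKf// opprB.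
by rewrite normrN normrM [leLHS]mulrC ler_wpM2r.
Qed.

(** Lists of consecutive intervals concatenate easily; this turns the indexed
    families of the definition into such lists. *)
Lemma abs_continuous_on_seq (V : normedModType R) (a b : R) (f : R -> V) :
  abs_continuous_on a b f -> forall e, 0 < e -> exists2 d, 0 < d &
  forall l : seq (R * R),
    all (fun p => [&& a <= p.1, p.1 <= p.2 & p.2 <= b]) l ->
    pairwise (fun p q => p.2 <= q.1) l ->
    \sum_(p <- l) (p.2 - p.1) < d -> \sum_(p <- l) `|f p.2 - f p.1| < e.
Proof.
move=> fac e e0; have [d d0 H] := fac e e0; exists d => // l l1 l2.
rewrite (big_nth (0, 0)) big_mkord => ld; rewrite (big_nth (0, 0)) big_mkord.
have lin (i : 'I_(size l)) := allP l1 _ (mem_nth (0, 0) (ltn_ord i)).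
apply: (H _ (fun i => (nth (0, 0) l i).1) (fun i => (nth (0, 0) l i).2)) => //.
  by move=> i; have /and3P[] := lin i.
apply/trivIsetP => i j _ _.
wlog ij : i j / (i < j)%N.
  move=> W; rewrite neq_ltn => /orP[ij|ji]; first by apply: W => //;
    rewrite neq_ltn ij.
  by rewrite setIC; apply: W => //; rewrite neq_ltn ji.
move=> _; have := (pairwiseP (0, 0) l2) i j;
  rewrite !inE => /(_ (ltn_ord i) (ltn_ord j) ij) le.
rewrite -subset0 => x [] /=; rewrite !in_itv/= => /andP[_ xi] /andP[jx _].
by have := lt_le_trans (lt_trans jx xi) le; rewrite ltxx.
Qed.

(** One half of the fundamental theorem of calculus for absolutely continuous
    functions, by the gauge argument described above.  The Cantor function shows
    that differentiability almost everywhere would not be enough. *)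
Lemma abs_continuous_growth (a b : R) (f df : R -> R) (t : R) :
  abs_continuous_on a b f ->
  {ae mu, forall s, s \in `[a, b] -> is_deriv_on a b f s (df s)} ->
  measurable_fun `[a, b] df -> t \in `[a, b] ->
  ((`|f t - f a|)%:E <= \int[mu]_(s in `[a, b]) (`|df s|)%:E)%E.
Proof.
move=> fac fdf mdf tab.
have [?|Ioo] := leP +oo%E (\int[mu]_(s in `[a, b]) (`|df s|)%:E)%E.
  by apply: le_trans (leey _) _.
have iab : mu.-integrable `[a, b] (EFin \o (fun s => `|df s|)).
  apply/integrableP; split; first by apply/measurable_EFinP;
    exact: measurableT_comp.
  by under eq_integral do rewrite /= normr_id.
(* Extended by zero, so that the indefinite integral [F] may start at -oo and its
   derivative is known almost everywhere on the whole line. *)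
pose phi := (fun s => `|df s|) \_ `[a, b].
have iphi : mu.-integrable setT (EFin \o phi).
  by rewrite /phi -restrict_EFin; apply/integrable_restrict => //; rewrite setTI.
have phi0 s : 0 <= phi s by rewrite /phi patchE; case: ifP.
pose F y := (\int[mu]_(s in `]-oo, y]) phi s)%R.
have iphiy y : mu.-integrable `]-oo, y] (EFin \o phi) by exact: integrableS iphi.
have dF : {ae mu, forall s, derivable F s 1 /\ derive1 F s = phi s}.
  by apply: FTC1Ny => //; exact: integrable_locally.
have FE y : (F y)%:E = (\int[mu]_(s in `]-oo, y]) (phi s)%:E)%E.
  by rewrite /F /Rintegral fineK//; exact: integrable_fin_num.
have mphi : measurable_fun setT (EFin \o phi) by case/integrableP: iphi.
have Fnd : {homo F : x y / x <= y}.
  move=> x y xy; rewrite -lee_fin !FE; apply: ge0_subset_integral => //=.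
  - exact: measurable_funTS.
  - by move=> s _; rewrite lee_fin.
  - by move=> s /=; rewrite !in_itv/= => /le_trans; apply.
have Fle : ((F t - F a)%:E <= \int[mu]_(s in `[a, b]) (`|df s|)%:E)%E.
  have -> : (\int[mu]_(s in `[a, b]) (`|df s|)%:E = \int[mu]_s (phi s)%:E)%E.
    by rewrite integral_mkcond; apply: eq_integral => s _; rewrite restrict_EFin.
  apply: (@le_trans _ _ (F t)%:E).
    by rewrite lee_fin lerBlDr lerDl; apply: Rintegral_ge0.
  rewrite FE; apply: ge0_subset_integral => //= s _; by rewrite lee_fin.
apply: le_trans Fle; rewrite lee_fin; apply/ler_addgt0Pr => e e0.
move: (tab); rewrite in_itv/= => /andP[at_ tb].
(* Makes the total error [e' (t - a) + e'] equal to [e]. *)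
pose e' := e / (t - a + 1).
have ta0 : 0 < t - a + 1 by rewrite ltr_wpDl// subr_ge0.
have e'0 : 0 < e' by rewrite divr_gt0.
have -> : e = e' * (t - a) + e'.
  by rewrite /e' -[X in _ + X]mulr1 -mulrDr divfK// gt_eqF.
have [d d0 acd] := abs_continuous_on_seq fac e'0.
have [A [mA A0 sub]] : mu.-negligible (~` [set s | (s \in `[a, b] ->
    is_deriv_on a b f s (df s)) /\ (derivable F s 1 /\ derive1 F s = phi s)]).
  exact: (@filterI _ _ (ae_filter_ringOfSetsType mu) _ _ fdf dF).
have [U [oU AU Ud]] : exists U : set R, [/\ open U, A `<=` U & (mu U < d%:E)%E].
  have [|U [oU AU Ud]] := lebesgue_regularity_outer mA _ d0;
    first by rewrite [X in (X < _)%E]A0.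
  exists U; split => //; move: Ud; rewrite (measureDI mu (open_measurable oU) mA).
  rewrite [X in (_ + X < _)%E](_ : _ = 0%E) ?adde0//.
  by apply: subset_measure0 A0 => //; apply: measurableI => //;
    exact: open_measurable.
have good s : s \in `[a, t] -> ~ U s -> \forall u \near s, u \in `[a, t] ->
     `|f u - f s| <= `|F u - F s| + e' * `|u - s|.
  rewrite in_itv/= => /andP[as_ st] nUs.
  have [fd [Fd Fp]] : (s \in `[a, b] -> is_deriv_on a b f s (df s)) /\
      (derivable F s 1 /\ derive1 F s = phi s).
    by apply: contrapT => nH; apply/nUs/AU/sub.
  have sab : s \in `[a, b] by rewrite in_itv/= as_ (le_trans st).
  have e2 : 0 < e' / 2 by rewrite divr_gt0.
  apply: filterS2 (is_deriv_on_near (fd sab) e2) (derivable_near Fd e2) => u Hf HF.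
  rewrite in_itv/= => /andP[au ut].
  have {Hf} : `|f u - f s - (u - s) *: df s| <= e' / 2 * `|u - s|.
    by apply: Hf; rewrite in_itv/= au (le_trans ut).
  move: HF; rewrite Fp /phi patchE mem_set// /GRing.scale/= => HF Hf.
  rewrite -[f u - f s](subrK ((u - s) * df s)).
  apply: (le_trans (ler_normD _ _)).
  have -> : `|(u - s) * df s| = `|(u - s) * `|df s| | by rewrite !normrM normr_id.
  rewrite -[(u - s) * `|df s|](subrK (F u - F s)).
  have := ler_normD ((u - s) * `|df s| - (F u - F s)) (F u - F s).
  by rewrite (distrC _ (F u - F s)); lra.
have [l [l1 l2 l3 l4]] := gauge_sum at_ (ltW e'0) oU Fnd good.
apply: (le_trans l4); rewrite addrA lerD2l; apply/ltW/acd => //.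
- by apply: sub_all l1 => p /and3P[-> -> /le_trans]; apply.
- by rewrite -lte_fin; exact: le_lt_trans Ud.
Qed.
End Growth.

(** * Weighted norms and orthogonal matrices *)

Section WeightedNorms.
Context {R : realType}.

Definition weighted_sq {n k : nat} (lam : 'rV[R]_k) (A : 'M[R]_(n, k)) : R :=
  \sum_i \sum_j lam ord0 j * A i j ^+ 2.

Definition frobenius_sq {n k : nat} (A : 'M[R]_(n, k)) : R :=
  weighted_sq (const_mx 1) A.

Lemma inner_LE n k (lam : 'rV[R]_k) (A : 'M[R]_(n, k)) :
  inner_L lam A A = weighted_sq lam A.
Proof.
rewrite /inner_L /mxtrace /weighted_sq exchange_big/=; apply: eq_bigr => j _.
rewrite mxE; apply: eq_bigr => i _.
by rewrite mul_diag_mx !mxE expr2 mulrA.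
Qed.

Lemma frobenius_sqE n k (A : 'M[R]_(n, k)) : frobenius_sq A = \tr (A^T *m A).
Proof. by rewrite /frobenius_sq -inner_LE /inner_L diag_const_mx mul1mx. Qed.

Lemma weighted_sq_ge0 n k (lam : 'rV[R]_k) (A : 'M[R]_(n, k)) :
  (forall j, 0 <= lam ord0 j) -> 0 <= weighted_sq lam A.
Proof.
move=> lam0; apply: sumr_ge0 => i _; apply: sumr_ge0 => j _.
by rewrite mulr_ge0// sqr_ge0.
Qed.

Lemma frobenius_sq_ge0 n k (A : 'M[R]_(n, k)) : 0 <= frobenius_sq A.
Proof. by apply: weighted_sq_ge0 => j; rewrite mxE. Qed.

Lemma weighted_sq_entry n k (lam : 'rV[R]_k) (A : 'M[R]_(n, k)) i j :
  (forall j, 0 <= lam ord0 j) -> lam ord0 j * A i j ^+ 2 <= weighted_sq lam A.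
Proof.
move=> lam0; rewrite /weighted_sq (bigD1 i)//= (bigD1 j)//= -addrA lerDl.
have H i' j' : 0 <= lam ord0 j' * A i' j' ^+ 2 by rewrite mulr_ge0// sqr_ge0.
by rewrite addr_ge0// sumr_ge0// => i' _; rewrite sumr_ge0.
Qed.

Lemma frobenius_sq_entry n k (A : 'M[R]_(n, k)) i j : A i j ^+ 2 <= frobenius_sq A.
Proof.
have := @weighted_sq_entry n k (const_mx 1) A i j; rewrite mxE mul1r; apply.
by move=> ?; rewrite mxE.
Qed.

Lemma weighted_sqN n k (lam : 'rV[R]_k) (A : 'M[R]_(n, k)) :
  weighted_sq lam (- A) = weighted_sq lam A.
Proof.
by apply: eq_bigr => i _; apply: eq_bigr => j _; rewrite mxE sqrrN.
Qed.

(** This inequality replaces the Cauchy-Schwarz inequality: it holds entry by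
    entry and is linear in the squared norms, so it can be integrated and passed
    to an infimum.  Minimising over [t] recovers the triangle inequality. *)
Lemma weighted_sq_young n k (lam : 'rV[R]_k) (A B : 'M[R]_(n, k)) t :
  (forall j, 0 <= lam ord0 j) -> 0 < t ->
  weighted_sq lam (A + B) <= (1 + t) * weighted_sq lam A +
    (1 + t^-1) * weighted_sq lam B.
Proof.
move=> lam0 t0; rewrite /weighted_sq !mulr_sumr -big_split/=; apply: ler_sum => i _.
rewrite !mulr_sumr -big_split/=; apply: ler_sum => j _.
rewrite mxE; set x := A i j; set y := B i j.
rewrite (mulrCA (1 + t)) (mulrCA (1 + t^-1)) -mulrDr ler_wpM2l//.
rewrite -subr_ge0.
have -> : (1 + t) * x ^+ 2 + (1 + t^-1) * y ^+ 2 - (x + y) ^+ 2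
    = t * (x - t^-1 * y) ^+ 2 by field; exact: lt0r_neq0.
by rewrite mulr_ge0// ?sqr_ge0// ltW.
Qed.

Lemma orthogonal_group_invr n (g : 'M[R]_n) :
  orthogonal_group g -> g *m g^T = 1%:M.
Proof. by move=> /mulmx1C. Qed.

Lemma orthogonal_group_tr n (g : 'M[R]_n) :
  orthogonal_group g -> orthogonal_group g^T.
Proof. by move=> og; rewrite /orthogonal_group/= trmxK orthogonal_group_invr. Qed.

Lemma orthogonal_group_mul n (g h : 'M[R]_n) :
  orthogonal_group g -> orthogonal_group h -> orthogonal_group (g *m h).
Proof.
move=> og oh; rewrite /orthogonal_group/= trmx_mul -mulmxA (mulmxA g^T) og.
by rewrite mul1mx.
Qed.

Lemma orthogonal_group1 n : orthogonal_group (1%:M : 'M[R]_n).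
Proof. by rewrite /orthogonal_group/= trmx1 mulmx1. Qed.

Lemma orthogonal_group_inv n (g : 'M[R]_n) :
  orthogonal_group g -> invmx g = g^T.
Proof.
move=> og; have ug := mulmx1_unit og.
by rewrite -[invmx g]mul1mx -og mulmxK//; case: ug.
Qed.

Lemma orthogonal_group_entry n (g : 'M[R]_n) i j :
  orthogonal_group g -> `|g i j| <= 1.
Proof.
move=> og; have /(congr1 (fun M : 'M[R]_n => M j j)) := og.
rewrite !mxE eqxx => E; rewrite -(@expr_le1 _ 2)// -normrX ger0_norm ?sqr_ge0//.
rewrite -[leRHS]E (bigD1 i)//= mxE -expr2 lerDl sumr_ge0// => l _.
by rewrite mxE -expr2 sqr_ge0.
Qed.

Lemma weighted_sq_mul_orthogonal n k (lam : 'rV[R]_k) (g : 'M[R]_n)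
    (A : 'M[R]_(n, k)) :
  orthogonal_group g -> weighted_sq lam (g *m A) = weighted_sq lam A.
Proof.
move=> og; rewrite -!inner_LE /inner_L trmx_mul -!mulmxA (mulmxA g^T) og.
by rewrite mul1mx.
Qed.

Lemma frobenius_sq_mul_orthogonal n (g A : 'M[R]_n) :
  orthogonal_group g -> frobenius_sq (A *m g) = frobenius_sq A.
Proof.
move=> og; rewrite !frobenius_sqE trmx_mul -!mulmxA mxtrace_mulC -!mulmxA.
by rewrite orthogonal_group_invr// mulmx1.
Qed.

Lemma frobenius_sq_tr n (A : 'M[R]_n) : frobenius_sq A^T = frobenius_sq A.
Proof. by rewrite !frobenius_sqE trmxK mxtrace_mulC. Qed.

Lemma norm_L_sqr n k (lam : 'rV[R]_k) (A : 'M[R]_(n, k)) :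
  (forall j, 0 <= lam ord0 j) -> norm_L lam A ^+ 2 = weighted_sq lam A.
Proof. by move=> lam0; rewrite /norm_L sqr_sqrtr inner_LE// weighted_sq_ge0. Qed.

Lemma norm_o_sqr n (W : 'M[R]_n) : norm_o W ^+ 2 = frobenius_sq W.
Proof. by rewrite /norm_o /inner_o -frobenius_sqE sqr_sqrtr// frobenius_sq_ge0. Qed.

(** The norm of the normed space of matrices is the maximum of the entries. *)
Lemma norm_mx_entry n k (A : 'M[R]_(n, k)) i j : `|A i j| <= `|A|.
Proof.
rewrite {2}/Num.norm/= mx_normrE.
exact: (le_bigmax _ (fun ij : 'I_n * 'I_k => `|A ij.1 ij.2|) (i, j)).
Qed.

Lemma norm_mx_le n k (A : 'M[R]_(n, k)) x : 0 <= x ->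
  (forall i j, `|A i j| <= x) -> `|A| <= x.
Proof.
move=> x0 Ax; rewrite {1}/Num.norm/= mx_normrE; apply: bigmax_le => // ij _.
Qed.
End WeightedNorms.

(** * Curves of class H1 in the orthogonal group *)

Section Curves.
Context {R : realType}.
Local Notation mu := (@lebesgue_measure R).

(** Absolute continuity passes to any function whose increments are dominated
    by those of two absolutely continuous ones. *)
Lemma abs_continuous_on_le (U V W : normedModType R) (a b M : R)
    (f : R -> U) (g : R -> V) (h : R -> W) :
  0 <= M -> abs_continuous_on a b g -> abs_continuous_on a b h ->
  {in `[a, b] &, forall x y,
     `|f y - f x| <= M * (`|g y - g x| + `|h y - h x|)} ->
  abs_continuous_on a b f.
Proof.
move=> M0 gac hac fle e e0.
have M1 : 0 < M + 1 by rewrite ltr_wpDl.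
have e'0 : 0 < e / (M + 1) / 2 by rewrite !divr_gt0.
have [d1 d10 H1] := gac _ e'0; have [d2 d20 H2] := hac _ e'0.
exists (Num.min d1 d2); first by rewrite lt_min d10.
move=> m x y xy tr; rewrite lt_min => /andP[sd1 sd2].
have {}H1 := H1 m x y xy tr sd1; have {}H2 := H2 m x y xy tr sd2.
have S : \sum_(i < m) `|f (y i) - f (x i)| <=
    M * (\sum_(i < m) `|g (y i) - g (x i)| + \sum_(i < m) `|h (y i) - h (x i)|).
  rewrite -big_split/= mulr_sumr; apply: ler_sum => i _; have [ax xy' yb] := xy i.
  by apply: fle; rewrite in_itv/= ?ax ?yb ?(le_trans ax)// (le_trans xy').
apply: (le_lt_trans S).
apply: (@le_lt_trans _ _ (M * (e / (M + 1)))).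
  by rewrite ler_wpM2l//; move: H1 H2; lra.
by rewrite mulrCA gtr_pMr// ltr_pdivrMr// mul1r ltrDl.
Qed.

Lemma abs_continuous_on_entry m n (a b : R) (A : R -> 'M[R]_(m, n)) i j :
  abs_continuous_on a b A -> abs_continuous_on a b (fun s => A s i j).
Proof.
move=> Aac; apply: (abs_continuous_on_le (M := 1) _ Aac Aac) => // x y _ _.
have := norm_mx_entry (A y - A x) i j; rewrite !mxE mul1r => /le_trans; apply.
by rewrite lerDl.
Qed.

Lemma abs_continuous_on_tr m n (a b : R) (A : R -> 'M[R]_(m, n)) :
  abs_continuous_on a b A -> abs_continuous_on a b (fun s => (A s)^T).
Proof.
move=> Aac; apply: (abs_continuous_on_le (M := 1) _ Aac Aac) => // x y _ _.
rewrite mul1r -linearB/= (@le_trans _ _ `|A y - A x|)// ?lerDl//.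
by apply: norm_mx_le => // i j; rewrite mxE norm_mx_entry.
Qed.

(** Products need bounded factors; orthogonality bounds all entries by [1]. *)
Lemma abs_continuous_on_orthogonal_mul n (a b : R) (g h : R -> 'M[R]_n) :
  {in `[a, b], forall s, orthogonal_group (g s)} ->
  {in `[a, b], forall s, orthogonal_group (h s)} ->
  abs_continuous_on a b g -> abs_continuous_on a b h ->
  abs_continuous_on a b (fun s => g s *m h s).
Proof.
move=> og oh gac hac.
apply: (abs_continuous_on_le (M := n%:R) _ gac hac) => // x y xab yab.
apply: norm_mx_le => [|i j]; first by rewrite mulr_ge0// addr_ge0.
rewrite !mxE -sumrB.
apply: (le_trans (ler_norm_sum _ _ _)).
rewrite mulr_natl -[X in _ *+ X]card_ord -sumr_const; apply: ler_sum => k _.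
have -> : g y i k * h y k j - g x i k * h x k j =
   (g y i k - g x i k) * h y k j + g x i k * (h y k j - h x k j) by ring.
apply: (le_trans (ler_normD _ _)); rewrite !normrM lerD//.
  have := norm_mx_entry (g y - g x) i k; rewrite !mxE; apply: le_trans.
  by rewrite ler_piMr//; apply: orthogonal_group_entry; apply: oh.
have := norm_mx_entry (h y - h x) k j; rewrite !mxE; apply: le_trans.
by rewrite ler_piMl//; apply: orthogonal_group_entry; apply: og.
Qed.

Lemma abs_continuous_on_cst (V : normedModType R) (a b : R) (x : V) :
  abs_continuous_on a b (fun=> x).
Proof.
move=> e e0; exists 1 => // m u v _ _ _.
by rewrite big1// => i _; rewrite subrr normr0.
Qed.

Lemma abs_continuous_on_continuous (V : normedModType R) (a b : R) (f : R -> V) :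
  abs_continuous_on a b f -> {within `[a, b], continuous f}.
Proof.
move=> fac; apply/subspace_continuousP => s sab; apply/cvgrPdist_le => e e0.
have [d d0 H] := abs_continuous_on_seq fac e0.
have K x y : x \in `[a, b] -> y \in `[a, b] -> x <= y -> y - x < d ->
    `|f y - f x| <= e.
  rewrite !in_itv/= => /andP[ax _] /andP[_ yb] xy yxd; apply: ltW.
  have := H [:: (x, y)]; rewrite !big_seq1/=; apply=> //.
  by rewrite ax xy yb.
rewrite near_withinE; apply/nbhs_ballP; exists d => //= t;
  rewrite /ball/= => st tab.
have [le_st|/ltW le_ts] := leP s t.
  by rewrite distrC; apply: K => //; apply: le_lt_trans st; rewrite distrC ler_norm.
by apply: K => //; apply: le_lt_trans st; rewrite ler_norm.
Qed.

Lemma continuous_on_measurable (a b : R) (f : R -> R) :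
  {within `[a, b], continuous f} -> measurable_fun `[a, b] f.
Proof. by move=> cf; apply: subspace_continuous_measurable_fun. Qed.

Lemma measurable_weighted_sq n k (D : set R) (lam : 'rV[R]_k)
    (A : R -> 'M[R]_(n, k)) :
  (forall i j, measurable_fun D (fun s => A s i j)) ->
  measurable_fun D (fun s => weighted_sq lam (A s)).
Proof.
move=> mA; apply: measurable_sum => i; apply: measurable_sum => j.
by apply: measurable_funM => //; apply: measurable_funX.
Qed.

Lemma measurable_mulmx m n p (D : set R) (A : R -> 'M[R]_(m, n))
    (B : R -> 'M[R]_(n, p)) :
  (forall i j, measurable_fun D (fun s => A s i j)) ->
  (forall i j, measurable_fun D (fun s => B s i j)) ->
  forall i j, measurable_fun D (fun s => (A s *m B s) i j).
Proof.
move=> mA mB i j; under eq_fun do rewrite mxE.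
by apply: measurable_sum => l; apply: measurable_funM.
Qed.

Lemma measurable_addmx m n (D : set R) (A B : R -> 'M[R]_(m, n)) :
  (forall i j, measurable_fun D (fun s => A s i j)) ->
  (forall i j, measurable_fun D (fun s => B s i j)) ->
  forall i j, measurable_fun D (fun s => (A s + B s) i j).
Proof.
move=> mA mB i j; under eq_fun do rewrite mxE.
exact: measurable_funD.
Qed.

Lemma H1_curve_measurable n (a b : R) (g dg : R -> 'M[R]_n) i j :
  H1_curve a b g dg -> measurable_fun `[a, b] (fun s => g s i j).
Proof.
case=> _ gac _ _; apply: continuous_on_measurable.
exact/abs_continuous_on_continuous/abs_continuous_on_entry.
Qed.

Lemma H1_curve_deriv_measurable n (a b : R) (g dg : R -> 'M[R]_n) i j :
  H1_curve a b g dg -> measurable_fun `[a, b] (fun s => dg s i j).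
Proof. by case=> _ _ _ /(_ i j)[]. Qed.

Lemma H1_curve_frobenius_sq_integrable n (a b : R) (g dg : R -> 'M[R]_n) :
  H1_curve a b g dg -> mu.-integrable `[a, b] (fun s => (frobenius_sq (dg s))%:E).
Proof.
case=> _ _ _ Hdg.
have -> : (fun s => (frobenius_sq (dg s))%:E) =
    (fun s => \sum_i \sum_j (dg s i j ^+ 2)%:E)%E.
  apply/funext => s; rewrite -sumEFin; apply: eq_bigr => i _.
  by rewrite -sumEFin; apply: eq_bigr => j _; rewrite mxE mul1r.
apply: integrable_sum => // i _; apply: integrable_sum => // j _.
by case: (Hdg i j).
Qed.

Lemma H1_curve_cst n (a b : R) (h : 'M[R]_n) :
  orthogonal_group h -> H1_curve a b (fun=> h) (fun=> 0).
Proof.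
move=> oh; split => //.
- exact: abs_continuous_on_cst.
- by apply: aeW => s _; exact: is_deriv_on_cst.
- move=> i j; rewrite mxE; split => //.
  by rewrite expr0n/=; exact: integrable0.
Qed.

Lemma H1_curve_tr n (a b : R) (g dg : R -> 'M[R]_n) :
  H1_curve a b g dg -> H1_curve a b (fun s => (g s)^T) (fun s => (dg s)^T).
Proof.
case=> og gac gd gi; split.
- by move=> s sab; apply/orthogonal_group_tr/og.
- exact: abs_continuous_on_tr.
- apply: filterS gd; first exact: (ae_filter_ringOfSetsType mu).
  by move=> s + sab => /(_ sab); exact: is_deriv_on_trmx.
- move=> i j; have [mji iji] := gi j i.
  split; first by under [X in measurable_fun _ X]eq_fun do rewrite mxE.
  by under [X in integrable _ _ X]eq_fun do rewrite mxE.
Qed.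

(** Closure under products is what makes minimal energies composable: the
    derivative stays square-integrable because orthogonal factors preserve the
    Frobenius norm. *)
Lemma H1_curve_mul n (a b : R) (g1 dg1 g2 dg2 : R -> 'M[R]_n) :
  H1_curve a b g1 dg1 -> H1_curve a b g2 dg2 ->
  H1_curve a b (fun s => g2 s *m g1 s)
    (fun s => dg2 s *m g1 s + g2 s *m dg1 s).
Proof.
move=> H1 H2; case: (H1) (H2) => og1 ac1 d1 _ [og2 ac2 d2 _].
have md i j : measurable_fun `[a, b]
    (fun s => (dg2 s *m g1 s + g2 s *m dg1 s) i j).
  by apply: measurable_addmx => {}i {}j; apply: measurable_mulmx => {}i {}j;
    solve [exact: H1_curve_measurable H1 | exact: H1_curve_measurable H2 |
           exact: H1_curve_deriv_measurable H1 |
           exact: H1_curve_deriv_measurable H2].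
split.
- by move=> s sab; apply: orthogonal_group_mul; [exact: og2|exact: og1].
- exact: abs_continuous_on_orthogonal_mul.
- have d12 := @filterI _ _ (ae_filter_ringOfSetsType mu) _ _ d1 d2.
  apply: filterS d12.
  by move=> s [/= d1s d2s] sab; apply: is_deriv_on_mulmx; [exact: d2s|exact: d1s].
- move=> i j; split; first exact: md.
  have I1 := H1_curve_frobenius_sq_integrable H1;
    have I2 := H1_curve_frobenius_sq_integrable H2.
  apply: (@le_integrable _ _ _ mu _ _ _
      (fun s => 2%:E * (frobenius_sq (dg2 s))%:E +
        2%:E * (frobenius_sq (dg1 s))%:E)%E) => //.
  + by apply/measurable_EFinP; apply: measurable_funX; exact: md.
  + move=> s sab; rewrite -!EFinM -EFinD !abse_EFin lee_fin.
    rewrite !ger0_norm ?sqr_ge0// ?addr_ge0 ?mulr_ge0 ?frobenius_sq_ge0//.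
    apply: (le_trans (frobenius_sq_entry _ i j)).
    have := @weighted_sq_young R n n (const_mx 1) (dg2 s *m g1 s) (g2 s *m dg1 s) 1.
    rewrite invr1 -!/(frobenius_sq _) frobenius_sq_mul_orthogonal; last exact: og1.
    by rewrite /frobenius_sq weighted_sq_mul_orthogonal; [apply => // k;
      rewrite mxE|exact: og2].
  + by apply: integrableD => //; exact: integrableZl.
Qed.
End Curves.

(** * Energy and minimal energy *)

(** With [p] and [q] the square roots of [x] and [y], the optimal weight [q / p]
    turns the right-hand side into [(p + q)^2]; both are shifted by a small [d]
    in case they vanish. *)
Lemma sqrt_triangle_of_young {R : realType} (x y z : R) : 0 <= x -> 0 <= y ->
  (forall t, 0 < t -> z <= (1 + t) * x + (1 + t^-1) * y) ->
  Num.sqrt z <= Num.sqrt x + Num.sqrt y.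
Proof.
move=> x0 y0 H; set p := Num.sqrt x; set q := Num.sqrt y.
have p0 : 0 <= p by exact: sqrtr_ge0.
have q0 : 0 <= q by exact: sqrtr_ge0.
have xE : x = p ^+ 2 by rewrite sqr_sqrtr.
have yE : y = q ^+ 2 by rewrite sqr_sqrtr.
suff zle : z <= (p + q) ^+ 2.
  rewrite -[leRHS]ger0_norm ?addr_ge0// -sqrtr_sqr; exact: ler_wsqrtr.
apply/ler_addgt0Pr => e e0.
have s0 : 0 < p + q + 1 by rewrite ltr_wpDl ?addr_ge0.
pose d := e / (p + q + 1).
have d0 : 0 < d by rewrite divr_gt0.
have de : d * (p + q) <= e.
  by rewrite /d mulrAC ler_pdivrMr// ler_wpM2l ?ltW// ltrDl.
have pd : 0 < p + d by rewrite ltr_wpDl.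
have qd : 0 < q + d by rewrite ltr_wpDl.
have HT := H ((q + d) / (p + d)) (divr_gt0 qd pd).
have P1 : p ^+ 2 * ((q + d) / (p + d)) <= p * (q + d).
  rewrite mulrA ler_pdivrMr// expr2 -!mulrA ler_wpM2l// mulrC ler_wpM2l ?ltW//.
  by rewrite ltrDl.
have Q1 : q ^+ 2 * ((q + d) / (p + d))^-1 <= q * (p + d).
  rewrite invf_div mulrA ler_pdivrMr// expr2 -!mulrA ler_wpM2l// mulrC.
  by rewrite ler_wpM2l ?ltW// ltrDl.
move: HT P1 Q1; rewrite xE yE; set t := _ / _; move: t (t^-1) => t t' HT P1 Q1.
by lra.
Qed.

Lemma young_slack {R : realFieldType} (x y e t : R) : 0 < t ->
  (1 + t) * (x + e / 2 / (1 + t)) + (1 + t^-1) * (y + e / 2 / (1 + t^-1)) <=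
  (1 + t) * x + (1 + t^-1) * y + e.
Proof.
move=> t0; have t1 : 0 < 1 + t by rewrite addr_gt0.
have t2 : 0 < 1 + t^-1 by rewrite addr_gt0// invr_gt0.
have h1 : (1 + t) * (e / 2 / (1 + t)) = e / 2 by rewrite mulrC divfK// gt_eqF.
have h2 : (1 + t^-1) * (e / 2 / (1 + t^-1)) = e / 2.
  by rewrite mulrC divfK// gt_eqF.
by rewrite !mulrDr h1 h2; move: t^-1 => ?; lra.
Qed.

Lemma sqrt_inj_le {R : realType} (x y : R) : 0 <= x -> 0 <= y ->
  Num.sqrt x <= Num.sqrt y -> Num.sqrt y <= Num.sqrt x -> x = y.
Proof.
by move=> x0 y0; rewrite !ler_sqrt// => xy yx; apply/eqP; rewrite eq_le xy.
Qed.

Section Energy.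
Context {R : realType} {n k : nat} (a b : R) (lam : 'rV[R]_k).
Context (ab : a < b) (lam_gt0 : forall j, 0 < lam ord0 j).
Local Notation mu := (@lebesgue_measure R).
Local Notation J := (jet a b k).
Implicit Types (c : R -> 'cV[R]_n) (g dg : R -> 'M[R]_n).

Let lam_ge0 j : 0 <= lam ord0 j. Proof. exact: ltW. Qed.

Let weighted_sq_lam_ge0 (A : 'M[R]_(n, k)) : 0 <= weighted_sq lam A.
Proof. exact: weighted_sq_ge0. Qed.

Definition energy_density c1 c2 g dg (s : R) : R :=
  weighted_sq lam (g s *m J c1 s - J c2 s) + frobenius_sq (dg s).

Lemma energy_density_ge0 c1 c2 g dg s : 0 <= energy_density c1 c2 g dg s.
Proof. by rewrite addr_ge0// ?weighted_sq_lam_ge0 ?frobenius_sq_ge0. Qed.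

(** The angular term does not see [g]: multiplication by the inverse of [g], which
    is orthogonal, preserves the Frobenius norm. *)
Lemma energyE c1 c2 g dg : H1_curve a b g dg ->
  energy a b lam c1 c2 g dg =
  ((2^-1)%:E * \int[mu]_(s in `[a, b]) (energy_density c1 c2 g dg s)%:E)%E.
Proof.
case=> og _ _ _; rewrite /energy; congr (_ * _)%E; apply: eq_integral => s.
rewrite inE/= => sab; rewrite norm_L_sqr// norm_o_sqr; congr (_ + _)%:E.
rewrite orthogonal_group_inv; last exact: og.
exact/weighted_sq_mul_orthogonal/orthogonal_group_tr/og.
Qed.

Lemma energy_ge0 c1 c2 g dg : (0 <= energy a b lam c1 c2 g dg)%E.
Proof.
rewrite /energy mule_ge0//; apply: integral_ge0 => s _.
by rewrite lee_fin addr_ge0// sqr_ge0.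
Qed.

Lemma jet_continuous c i j : Ck a b k c ->
  {within `[a, b], continuous (fun s => J c s i j)}.
Proof.
move=> cC.
rewrite (_ : (fun s => _) = (fun s => nth_deriv_on a b j.+1 c s i ord0)).
  apply/subspace_continuousP => s sab.
  by have /subspace_continuousP/(_ s sab)/cvg_mxP/(_ i ord0) :=
    Ck_continuous cC (ltn_ord j).
by apply/funext => s; rewrite mxE.
Qed.

Lemma jet_measurable c i j : Ck a b k c ->
  measurable_fun `[a, b] (fun s => J c s i j).
Proof. by move=> /jet_continuous cJ; apply: continuous_on_measurable. Qed.

Lemma jet_diff_measurable c1 c2 g dg i j : Ck a b k c1 -> Ck a b k c2 ->
  H1_curve a b g dg ->
  measurable_fun `[a, b] (fun s => (g s *m J c1 s - J c2 s) i j).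
Proof.
move=> C1 C2 Hg; apply: measurable_addmx => {}i {}j.
  apply: measurable_mulmx => {}i {}j; last exact: jet_measurable.
  exact: H1_curve_measurable Hg.
under [X in measurable_fun _ X]eq_fun do rewrite mxE.
by apply: measurable_funN; exact: jet_measurable.
Qed.

Lemma energy_density_measurable c1 c2 g dg : Ck a b k c1 -> Ck a b k c2 ->
  H1_curve a b g dg -> measurable_fun `[a, b] (energy_density c1 c2 g dg).
Proof.
move=> C1 C2 Hg; apply: measurable_funD; apply: measurable_weighted_sq => i j.
  exact: jet_diff_measurable Hg.
exact: H1_curve_deriv_measurable Hg.
Qed.

(** The weights are exchanged for the angular term, since there the derivative
    [g2 dg1] of the first curve comes second; applying Young's inequality with
    [1/t] puts them back. *)
Lemma density_young (g1 dg1 g2 dg2 : 'M[R]_n) (A B C : 'M[R]_(n, k)) t :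
  0 < t -> orthogonal_group g1 -> orthogonal_group g2 ->
  weighted_sq lam (g2 *m g1 *m A - C) + frobenius_sq (dg2 *m g1 + g2 *m dg1) <=
  (1 + t) * (weighted_sq lam (g1 *m A - B) + frobenius_sq dg1) +
  (1 + t^-1) * (weighted_sq lam (g2 *m B - C) + frobenius_sq dg2).
Proof.
move=> t0 og1 og2.
have -> : g2 *m g1 *m A - C = g2 *m (g1 *m A - B) + (g2 *m B - C).
  by rewrite mulmxBr mulmxA addrA subrK.
have L := weighted_sq_young (g2 *m (g1 *m A - B)) (g2 *m B - C) lam_ge0 t0.
have ti : 0 < t^-1 by rewrite invr_gt0.
have one_ge0 (j : 'I_n) : 0 <= (const_mx 1 : 'rV[R]_n) ord0 j by rewrite mxE.
have F := weighted_sq_young (dg2 *m g1) (g2 *m dg1) one_ge0 ti.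
move: F L; rewrite -!/(frobenius_sq _) invrK frobenius_sq_mul_orthogonal//.
rewrite /frobenius_sq !(weighted_sq_mul_orthogonal _ _ og2) => F L.
rewrite !mulrDr; move: F L => /lerD /[apply]; congr (_ <= _); ring.
Qed.

Lemma energy_young c1 c2 c3 g1 dg1 g2 dg2 t : 0 < t ->
  Ck a b k c1 -> Ck a b k c2 -> Ck a b k c3 ->
  H1_curve a b g1 dg1 -> H1_curve a b g2 dg2 ->
  (energy a b lam c1 c3 (fun s => g2 s *m g1 s)
     (fun s => dg2 s *m g1 s + g2 s *m dg1 s)%R
   <= (1 + t)%:E * energy a b lam c1 c2 g1 dg1
      + (1 + t^-1)%:E * energy a b lam c2 c3 g2 dg2)%E.
Proof.
move=> t0 C1 C2 C3 H1 H2; have H12 := H1_curve_mul H1 H2.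
have t1 : 0 <= 1 + t by rewrite addr_ge0// ltW.
have t2 : 0 <= 1 + t^-1 by rewrite addr_ge0// invr_ge0 ltW.
have m1 := energy_density_measurable C1 C2 H1;
  have m2 := energy_density_measurable C2 C3 H2.
rewrite !energyE// muleCA [X in (_ <= _ + X)%E]muleCA -muleDr//; last first.
  by apply: ge0_adde_def; rewrite inE mule_ge0// ?lee_fin//;
    apply: integral_ge0 => s _; rewrite lee_fin energy_density_ge0.
rewrite lee_wpmul2l ?lee_fin//.
have D1 s : (0 <= (energy_density c1 c2 g1 dg1 s)%:E)%E
  by rewrite lee_fin energy_density_ge0.
have D2 s : (0 <= (energy_density c2 c3 g2 dg2 s)%:E)%E
  by rewrite lee_fin energy_density_ge0.
rewrite -!ge0_integralZl//; try exact/measurable_EFinP.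
rewrite -ge0_integralD//; try by [move=> s _; rewrite mule_ge0// lee_fin
  |apply: measurable_funeM; exact/measurable_EFinP].
apply: ge0_le_integral => //.
- by move=> s _; rewrite lee_fin energy_density_ge0.
- apply/measurable_EFinP; exact: (energy_density_measurable C1 C3 H12).
- by apply: emeasurable_funD; apply: measurable_funeM; exact/measurable_EFinP.
- case: (H1) (H2) => og1 _ _ _ [og2 _ _ _] s sab.
  rewrite -!EFinM -EFinD lee_fin.
  by apply: density_young => //; [exact: og1|exact: og2].
Qed.

Lemma density_tr (g dg : 'M[R]_n) (A B : 'M[R]_(n, k)) : orthogonal_group g ->
  weighted_sq lam (g^T *m B - A) + frobenius_sq dg^T =
    weighted_sq lam (g *m A - B) + frobenius_sq dg.
Proof.
move=> og; rewrite frobenius_sq_tr; congr (_ + _).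
rewrite -(weighted_sq_mul_orthogonal _ _ og) mulmxBr mulmxA
  orthogonal_group_invr// mul1mx.
by rewrite -weighted_sqN opprB.
Qed.

Lemma energy_tr c1 c2 g dg : H1_curve a b g dg ->
  energy a b lam c2 c1 (fun s => (g s)^T) (fun s => (dg s)^T) =
  energy a b lam c1 c2 g dg.
Proof.
move=> Hg; rewrite !energyE//; last exact: H1_curve_tr.
congr (_ * _)%E; apply: eq_integral => s; rewrite inE/= => sab.
have og : orthogonal_group (g s) by case: Hg => og _ _ _; exact: og.
congr (_%:E); exact: (density_tr (dg s) (J c1 s) (J c2 s) og).
Qed.

Lemma jet_rigid c c' (h : 'M[R]_n) x : Ck a b k c ->
  {in `[a, b], forall s, c' s = h *m c s + x} ->
  {in `[a, b], forall s, J c' s = h *m J c s}.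
Proof.
move=> cC c'E s sab; apply/matrixP => i j; rewrite !mxE.
have [-> _] := nth_deriv_on_rigid ab cC c'E (ltn_ord j) sab.
by rewrite mxE; apply: eq_bigr => l _; rewrite mxE.
Qed.

Lemma energy_rigid c c' (h : 'M[R]_n) x : Ck a b k c -> orthogonal_group h ->
  {in `[a, b], forall s, c' s = h *m c s + x} ->
  energy a b lam c c' (fun=> h) (fun=> 0) = 0%E.
Proof.
move=> cC oh c'E; rewrite energyE; last exact: H1_curve_cst.
rewrite (_ : (\int[mu]_(s in _) _ = 0)%E) ?mule0//.
apply: integral0_eq => s sab; rewrite /energy_density (jet_rigid cC c'E)// subrr.
by rewrite /frobenius_sq /weighted_sq !big1 ?addr0// => i _; rewrite big1// => j _;
  rewrite !mxE expr0n mulr0.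
Qed.

Lemma continuous_on_sqr_integrable (f : R -> R) :
  {within `[a, b], continuous f} ->
  mu.-integrable `[a, b] (fun s => (f s ^+ 2)%:E).
Proof.
move=> cf; have -> : (fun s => (f s ^+ 2)%:E) = EFin \o (fun s => f s * f s).
  by apply/funext => s /=; rewrite expr2.
apply: continuous_compact_integrable; first exact: segment_compact.
apply/subspace_continuousP => s sab.
have /subspace_continuousP/(_ s sab) fs := cf.
exact: (cvgM fs fs).
Qed.

Lemma weighted_sq_jet_integrable c : Ck a b k c ->
  mu.-integrable `[a, b] (fun s => (weighted_sq lam (J c s))%:E).
Proof.
move=> cC.
have -> : (fun s => (weighted_sq lam (J c s))%:E) =
    (fun s => \sum_i \sum_j (lam ord0 j)%:E * (J c s i j ^+ 2)%:E)%E.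
  apply/funext => s; rewrite -sumEFin; apply: eq_bigr => i _.
  by rewrite -sumEFin; apply: eq_bigr => j _.
apply: integrable_sum => // i _; apply: integrable_sum => // j _.
by apply: integrableZl => //; apply: continuous_on_sqr_integrable;
  exact: jet_continuous.
Qed.

Lemma density1_le (A B : 'M[R]_(n, k)) :
  weighted_sq lam (1%:M *m A - B) + frobenius_sq (0 : 'M[R]_n) <=
    2 * weighted_sq lam A + 2 * weighted_sq lam B.
Proof.
have -> : frobenius_sq (0 : 'M[R]_n) = 0.
  by rewrite /frobenius_sq /weighted_sq big1// => i _; rewrite big1// => j _;
    rewrite !mxE expr0n mulr0.
have := weighted_sq_young A (- B) lam_ge0 ltr01.
by rewrite weighted_sqN invr1 mul1mx addr0.
Qed.

Lemma energy1_lty c1 c2 : Ck a b k c1 -> Ck a b k c2 ->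
  (energy a b lam c1 c2 (fun=> 1%:M) (fun=> 0%R) < +oo)%E.
Proof.
move=> C1 C2; have H1 := @H1_curve_cst R n a b _ (orthogonal_group1 n).
rewrite energyE//.
suff /integrable_fin_num/= : mu.-integrable `[a, b]
    (fun s => (energy_density c1 c2 (fun=> 1%:M) (fun=> 0%R) s)%:E).
  move=> /(_ (measurable_itv _)); rewrite fin_num_abs => fI.
  by rewrite ltey_eq fin_numM// fin_num_abs.
apply: (@le_integrable _ _ _ mu _ _ _
   (fun s => 2%:E * (weighted_sq lam (J c1 s))%:E +
     2%:E * (weighted_sq lam (J c2 s))%:E)%E) => //.
- by apply/measurable_EFinP; exact: energy_density_measurable.
- move=> s sab.
  rewrite gee0_abs; last by rewrite lee_fin; exact: energy_density_ge0.
  apply: le_trans (lee_abs _).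
  have L := density1_le (J c1 s) (J c2 s).
  by rewrite -lee_fin in L; exact: L.
- by apply: integrableD => //; apply: integrableZl => //;
  exact: weighted_sq_jet_integrable.
Qed.

Local Notation D := (@min_energy R n k a b lam).

Lemma min_energy_le c1 c2 g dg : H1_curve a b g dg ->
  (D c1 c2 <= energy a b lam c1 c2 g dg)%E.
Proof. by move=> Hg; apply: ereal_inf_lbound; exists g, dg. Qed.

Lemma min_energy_ge0 c1 c2 : (0 <= D c1 c2)%E.
Proof. by apply: le_ereal_inf_tmp => _ [g [dg [_ ->]]]; exact: energy_ge0. Qed.

(** The constant curve [1] already has finite energy, as jets are continuous. *)
Lemma min_energy_fin c1 c2 : Ck a b k c1 -> Ck a b k c2 ->
  D c1 c2 \is a fin_num.
Proof.
move=> C1 C2; rewrite ge0_fin_numE ?min_energy_ge0//.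
apply: le_lt_trans (energy1_lty C1 C2).
by apply/min_energy_le/H1_curve_cst/orthogonal_group1.
Qed.

Lemma min_energy_approx c1 c2 e : Ck a b k c1 -> Ck a b k c2 -> 0 < e ->
  exists g dg, H1_curve a b g dg /\
    (energy a b lam c1 c2 g dg <= D c1 c2 + e%:E)%E.
Proof.
move=> C1 C2 e0.
have : (D c1 c2 < D c1 c2 + e%:E)%E by rewrite lteDl// min_energy_fin.
by move=> /ereal_inf_lt[_ [g [dg [Hg ->]]] /ltW]; exists g, dg.
Qed.

Lemma min_energy_sym c1 c2 : D c1 c2 = D c2 c1.
Proof.
suff H c c' : (D c c' <= D c' c)%E.
  by apply/eqP; rewrite eq_le; apply/andP; split; exact: H.
apply: le_ereal_inf_tmp => _ [g [dg [Hg ->]]]; rewrite -(energy_tr c' c Hg).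
exact/min_energy_le/H1_curve_tr.
Qed.

Lemma min_energy_young c1 c2 c3 t : 0 < t ->
  Ck a b k c1 -> Ck a b k c2 -> Ck a b k c3 ->
  fine (D c1 c3) <= (1 + t) * fine (D c1 c2) + (1 + t^-1) * fine (D c2 c3).
Proof.
move=> t0 C1 C2 C3; apply/ler_addgt0Pr => e e0.
have t1 : 0 < 1 + t by rewrite addr_gt0.
have t2 : 0 < 1 + t^-1 by rewrite addr_gt0// invr_gt0.
have e1 : 0 < e / 2 / (1 + t) by rewrite !divr_gt0.
have e2 : 0 < e / 2 / (1 + t^-1) by rewrite !divr_gt0.
have [g1 [dg1 [H1 E1]]] := min_energy_approx C1 C2 e1.
have [g2 [dg2 [H2 E2]]] := min_energy_approx C2 C3 e2.
rewrite -lee_fin fineK ?min_energy_fin//.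
apply: (le_trans (min_energy_le _ _ (H1_curve_mul H1 H2))).
apply: (le_trans (energy_young t0 C1 C2 C3 H1 H2)).
move: E1 E2; rewrite -(fineK (min_energy_fin C1 C2))
  -(fineK (min_energy_fin C2 C3)).
have t1' : (0 <= (1 + t)%:E)%E by rewrite lee_fin ltW.
have t2' : (0 <= (1 + t^-1)%:E)%E by rewrite lee_fin ltW.
move=> /(lee_wpmul2l t1') E1 /(lee_wpmul2l t2') E2.
apply: (le_trans (leeD E1 E2)).
have L := young_slack (fine (D c1 c2)) (fine (D c2 c3)) e t0.
by rewrite -lee_fin in L; exact: L.
Qed.

Lemma min_energy_rigid c c' : Ck a b k c -> euclidean_orbit a b k c c' ->
  D c c' = 0%E.
Proof.
move=> cC [c'C [h oh [x c'E]]]; apply/eqP; rewrite eq_le min_energy_ge0 andbT.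
rewrite -(energy_rigid cC oh c'E); exact/min_energy_le/H1_curve_cst.
Qed.

Lemma sqrt_min_energy_triangle c1 c2 c3 :
  Ck a b k c1 -> Ck a b k c2 -> Ck a b k c3 ->
  Num.sqrt (fine (D c1 c3)) <=
  Num.sqrt (fine (D c1 c2)) + Num.sqrt (fine (D c2 c3)).
Proof.
move=> C1 C2 C3; apply: sqrt_triangle_of_young.
- by apply: fine_ge0; exact: min_energy_ge0.
- by apply: fine_ge0; exact: min_energy_ge0.
- by move=> t t0; exact: min_energy_young.
Qed.

(** Invariance needs no computation: two curves at distance zero have the same
    distance to any third one. *)
Lemma min_energy_orbit c1 c1' c2 : Ck a b k c1 -> Ck a b k c2 ->
  euclidean_orbit a b k c1 c1' -> D c1' c2 = D c1 c2.
Proof.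
move=> C1 C2 o1; have C1' : Ck a b k c1' by case: o1.
have D0 := min_energy_rigid C1 o1.
have F0 c c' : 0 <= fine (D c c') by apply: fine_ge0; exact: min_energy_ge0.
have T1 := sqrt_min_energy_triangle C1' C1 C2.
have T2 := sqrt_min_energy_triangle C1 C1' C2.
rewrite (min_energy_sym c1' c1) D0 sqrtr0 add0r in T1.
rewrite D0 sqrtr0 add0r in T2.
rewrite -(fineK (min_energy_fin C1' C2)) -(fineK (min_energy_fin C1 C2)).
apply: (congr1 EFin).
exact: sqrt_inj_le (F0 _ _) (F0 _ _) T1 T2.
Qed.
End Energy.

(** * Curves of rotations of small energy *)

Section Vanishing.
Context {R : realType}.
Local Notation mu := (@lebesgue_measure R).

(** A mean value inequality for one-sided derivatives at the end points and values
    in any normed space, again by Cousin's lemma. *)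
Lemma is_deriv_on_lipschitz (V : normedModType R) (a b M : R) (f df : R -> V) :
  {in `[a, b], forall s, is_deriv_on a b f s (df s)} ->
  {in `[a, b], forall s, `|df s| <= M} ->
  {in `[a, b] &, forall x y, `|f y - f x| <= (M + 1) * `|y - x|}.
Proof.
move=> fdf dfM x y xab yab.
wlog xy : x y xab yab / x <= y.
  move=> W; have [xy|/ltW yx] := leP x y; first exact: W.
  by rewrite distrC (distrC y); exact: W.
have M0 : 0 <= M + 1 by have := le_trans (normr_ge0 _) (dfM x xab); lra.
rewrite (ger0_norm (x := y - x)) ?subr_ge0//.
apply: (cousin (P := fun u v => `|f v - f u| <= (M + 1) * (v - u)) xy).
  move=> u v w _ uv vw _ Huv Hvw.
  have -> : f w - f u = (f w - f v) + (f v - f u) by rewrite addrA subrK.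
  by apply: (le_trans (ler_normD _ _)); lra.
move=> s; rewrite in_itv/= => /andP[xs sy].
move: (xab) (yab); rewrite !in_itv/= => /andP[ax _] /andP[_ yb].
have sab : s \in `[a, b] by rewrite in_itv/= (le_trans ax)// (le_trans sy).
have /nbhs_ballP[d /= d0 H] := is_deriv_on_near (fdf s sab) ltr01.
exists d => // u v xu us sv vy ud vd.
have K w : x <= w -> w <= y -> `|s - w| < d -> `|f w - f s| <= (M + 1) * `|w - s|.
  move=> xw wy sw; rewrite -[f w - f s](subrK ((w - s) *: df s)) mulrDl mul1r addrC.
  apply: (le_trans (ler_normD _ _)); apply: lerD.
    by rewrite normrZ mulrC ler_wpM2r ?dfM.
  rewrite -[leRHS]mul1r; apply: H => //.
  by rewrite in_itv/= (le_trans ax)// (le_trans wy).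
have -> : f v - f u = (f v - f s) - (f u - f s) by rewrite opprB addrA subrK.
apply: (le_trans (ler_normB _ _)).
have := K u xu (le_trans us sy); have := K v (le_trans xs sv) vy.
rewrite (ger0_norm (x := v - s)) ?subr_ge0// (ler0_norm (x := u - s)) ?subr_le0//.
rewrite distrC (ger0_norm (x := v - s)) ?subr_ge0//
  (ger0_norm (x := s - u)) ?subr_ge0//.
by move=> /(_ vd) Hv /(_ ud) Hu; lra.
Qed.

Lemma abs_continuous_on_id (a b : R) : abs_continuous_on a b (@id R).
Proof.
move=> e e0; exists e => // m x y xy _; apply: le_lt_trans; apply: ler_sum => i _.
by have [_ xyi _] := xy i; rewrite ger0_norm ?subr_ge0.
Qed.

Lemma Ck_abs_continuous (V : normedModType R) (a b : R) k (c : R -> V) :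
  (0 < k)%N -> Ck a b k c -> exists2 M, 0 <= M &
    {in `[a, b], forall s, `|nth_deriv_on a b 1 c s| <= M} /\
    abs_continuous_on a b c.
Proof.
move=> k0 cC; have cc := Ck_continuous cC k0.
have /compact_bounded[M [_ Mc]] := continuous_compact cc (@segment_compact R a b).
pose N := `|M| + 1.
have N0 : 0 <= N by rewrite addr_ge0.
have cN : {in `[a, b], forall s, `|nth_deriv_on a b 1 c s| <= N}.
  move=> s sab; apply: Mc; last by exists s.
  by rewrite (le_lt_trans (ler_norm _))// ltrDl.
exists N => //; split=> //.
have N1 : 0 <= N + 1 by rewrite addr_ge0.
have iac := abs_continuous_on_id a b.
apply: (abs_continuous_on_le N1 iac iac) => x y xab yab.
have H s : s \in `[a, b] -> is_deriv_on a b c s (nth_deriv_on a b 1 c s).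
  by move=> sab; case: cC => /(_ 0%N s k0 sab).
apply: (le_trans (is_deriv_on_lipschitz H cN xab yab)).
by rewrite ler_wpM2l// lerDl.
Qed.

(** Integrating [|w| <= (e + w^2 / e) / 2]: if [w^2] has integral of order [e^2]
    then [w] has integral of order [e]. *)
Lemma L1_le_L2 (a b e : R) (w : R -> R) (I : \bar R) : a <= b -> 0 < e ->
  measurable_fun `[a, b] w ->
  (\int[mu]_(s in `[a, b]) (w s ^+ 2)%:E <= I)%E ->
  (\int[mu]_(s in `[a, b]) (`|w s|)%:E
   <= (e / 2 * (b - a))%:E + (e^-1 / 2)%:E * I)%E.
Proof.
move=> ab e0 mw wI.
have e2 : 0 <= e^-1 / 2 by rewrite divr_ge0// invr_ge0 ltW.
have e3 : 0 <= e / 2 by rewrite divr_ge0// ltW.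
have mw2 : measurable_fun `[a, b] (fun s => (w s ^+ 2)%:E).
  by apply/measurable_EFinP; exact: measurable_funX.
apply: (@le_trans _ _
    (\int[mu]_(s in `[a, b]) ((e / 2)%:E + (e^-1 / 2)%:E * (w s ^+ 2)%:E))%E).
  apply: ge0_le_integral => //.
  - by apply/measurable_EFinP; exact: measurableT_comp.
  - by apply: emeasurable_funD => //; apply: measurable_funeM.
  - move=> s _; rewrite -EFinM -EFinD lee_fin -subr_ge0
    -(real_normK (num_real (w s))).
    have -> : e / 2 + e^-1 / 2 * `|w s| ^+ 2 - `|w s| =
        e^-1 / 2 * (`|w s| - e) ^+ 2 by field; rewrite gt_eqF.
    by rewrite mulr_ge0// sqr_ge0.
rewrite ge0_integralD//; last 2 first.
  - by move=> s _; rewrite -EFinM lee_fin mulr_ge0// sqr_ge0.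
  - exact: measurable_funeM.
rewrite integral_cst//= lebesgue_measure_itv/= ge0_integralZl//; last first.
  by move=> s _; rewrite lee_fin sqr_ge0.
apply: leeD; last by rewrite lee_wpmul2l.
case: ifP => _; first exact: lexx.
by rewrite mule0 lee_fin mulr_ge0// subr_ge0.
Qed.

(** A curve of rotations of energy [e^2] oscillates by at most a multiple
    of [e]. *)
Lemma rotation_oscillation n (a b e : R) (g dg : R -> 'M[R]_n) :
  a <= b -> 0 < e -> H1_curve a b g dg ->
  (\int[mu]_(s in `[a, b]) (frobenius_sq (dg s))%:E <= (2 * e ^+ 2)%:E)%E ->
  {in `[a, b], forall s i j, `|g s i j - g a i j| <= e * ((b - a) / 2 + 1)}.
Proof.
move=> ab e0 Hg dge s sab i j; case: (Hg) => _ gac gd _.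
have mdg := H1_curve_deriv_measurable i j Hg.
have dij : {ae mu, forall s, s \in `[a, b] ->
    is_deriv_on a b (fun t => g t i j) s (dg s i j)}.
  apply: filterS gd; first exact: (ae_filter_ringOfSetsType mu).
  by move=> u + uab => /(_ uab)/is_deriv_on_mxP.
have Hgr := abs_continuous_growth (abs_continuous_on_entry i j gac) dij mdg sab.
rewrite -lee_fin; apply: (le_trans Hgr).
have I2 : (\int[mu]_(s in `[a, b]) (dg s i j ^+ 2)%:E <= (2 * e ^+ 2)%:E)%E.
  apply: le_trans dge; apply: ge0_le_integral => //.
  - by move=> u _; rewrite lee_fin sqr_ge0.
  - by apply/measurable_EFinP; exact: measurable_funX.
  - apply/measurable_EFinP; apply: measurable_weighted_sq => i' j'.
    exact: H1_curve_deriv_measurable Hg.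
  - by move=> u _; rewrite lee_fin frobenius_sq_entry.
apply: (le_trans (L1_le_L2 ab e0 mdg I2)).
rewrite -EFinM -EFinD lee_fin.
have -> : e^-1 / 2 * (2 * e ^+ 2) = e by field; rewrite gt_eqF.
suff <- : e / 2 * (b - a) + e = e * ((b - a) / 2 + 1) by [].
by field.
Qed.

Lemma is_deriv_onB a b (V : normedModType R) (f g : R -> V) s l m :
  is_deriv_on a b f s l -> is_deriv_on a b g s m ->
  is_deriv_on a b (fun t => f t - g t) s (l - m).
Proof.
move=> fl gm; apply: is_deriv_onD => //; rewrite /is_deriv_on.
rewrite (_ : (fun t => _) = (fun t => - ((t - s)^-1 *: (g t - g s)))).
  exact: cvgN gm.
by apply/funext => t; rewrite -scalerN opprD.
Qed.

Lemma norm_mulmx_entry m n p (A : 'M[R]_(m, n)) (B : 'M[R]_(n, p)) i j x y :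
  0 <= x -> (forall l, `|A i l| <= x) -> (forall l, `|B l j| <= y) ->
  `|(A *m B) i j| <= n%:R * (x * y).
Proof.
move=> x0 Ax By; rewrite mxE; apply: (le_trans (ler_norm_sum _ _ _)).
rewrite mulr_natl -[X in _ *+ X]card_ord -sumr_const; apply: ler_sum => l _.
by rewrite normrM ler_pM.
Qed.

(** Only the first column of the jets is used.  The derivative of
    [h c1 - c2] differs from that column of [g J c1 - J c2], which is small in
    mean, by [(h - g) c1'], which is small uniformly. *)
Lemma near_rotation_bound n k (a b e eta M : R) (lam : 'rV[R]_k) (j0 : 'I_k)
    (c1 c2 : R -> 'cV[R]_n) (g dg : R -> 'M[R]_n) (h : 'M[R]_n) :
  a <= b -> 0 < e -> 0 <= eta -> 0 <= M -> j0 = 0%N :> nat ->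
  (forall j, 0 < lam ord0 j) -> Ck a b k c1 -> Ck a b k c2 ->
  {in `[a, b], forall s, `|nth_deriv_on a b 1 c1 s| <= M} ->
  H1_curve a b g dg ->
  orthogonal_group h ->
  {in `[a, b], forall s i j, `|g s i j - h i j| <= eta} ->
  (\int[mu]_(s in `[a, b])
     (weighted_sq lam (g s *m jet a b k c1 s - jet a b k c2 s))%:E <=
       (2 * e ^+ 2)%:E)%E ->
  {in `[a, b], forall t i,
     `|(h *m (c1 t - c1 a) - (c2 t - c2 a)) i ord0| <=
       e / 2 * (b - a) + e / lam ord0 j0 + n%:R * eta * M * (b - a)}.
Proof.
move=> ab e0 eta0 M0 j00 lam0 C1 C2 c1M Hg oh gh Ie t tab i.
have k0 : (0 < k)%N by exact: leq_ltn_trans (ltn_ord j0).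
have l00 := lam0 j0.
pose c1' := nth_deriv_on a b 1 c1; pose c2' := nth_deriv_on a b 1 c2.
have jE c s i' : jet a b k c s i' j0 = nth_deriv_on a b 1 c s i' ord0.
  by rewrite mxE j00.
have colE (A : 'M[R]_n) s : (A *m jet a b k c1 s - jet a b k c2 s) i j0 =
    (A *m c1' s - c2' s) i ord0.
  rewrite [LHS]mxE [RHS]mxE; congr (_ + _).
    by rewrite [LHS]mxE [RHS]mxE; apply: eq_bigr => l _; rewrite jE.
  by rewrite [LHS]mxE [RHS]mxE jE.
have incr x y : (h *m c1 y - c2 y) i ord0 - (h *m c1 x - c2 x) i ord0 =
    (h *m (c1 y - c1 x) - (c2 y - c2 x)) i ord0.
  by rewrite mulmxBr !mxE; ring.
pose w s := (g s *m jet a b k c1 s - jet a b k c2 s) i j0.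
pose psi s := (h *m c1' s - c2' s) i ord0.
have mw : measurable_fun `[a, b] w by exact: jet_diff_measurable Hg.
have mpsi : measurable_fun `[a, b] psi.
  have -> : psi = (fun s => (h *m jet a b k c1 s - jet a b k c2 s) i j0).
    by apply/funext => s; rewrite colE.
  exact: (jet_diff_measurable _ _ C1 C2 (H1_curve_cst a b oh)).
have [_ _ [_ c1ac]] := Ck_abs_continuous k0 C1.
have [_ _ [_ c2ac]] := Ck_abs_continuous k0 C2.
have phac : abs_continuous_on a b (fun s => (h *m c1 s - c2 s) i ord0).
  apply: (abs_continuous_on_le (M := n%:R + 1) _ c1ac c2ac) => //.
  move=> x y _ _; rewrite incr mxE [X in _ + X]mxE.
  apply: (le_trans (ler_normB _ _)).
  have H1 : `|(h *m (c1 y - c1 x)) i ord0| <= n%:R * (1 * `|c1 y - c1 x|).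
    apply: norm_mulmx_entry => // l; first exact: orthogonal_group_entry.
    exact: norm_mx_entry.
  have H2 := norm_mx_entry (c2 y - c2 x) i ord0.
  apply: (le_trans (lerD H1 H2)).
  rewrite mul1r mulrDr lerD//; first by rewrite ler_wpM2r// lerDl.
  by rewrite ler_peMl// lerDr.
have dph : {ae mu, forall s, s \in `[a, b] ->
    is_deriv_on a b (fun t => (h *m c1 t - c2 t) i ord0) s (psi s)}.
  apply: aeW => s sab.
  have d1 : is_deriv_on a b c1 s (c1' s) by case: C1 => /(_ 0%N s k0 sab).
  have d2 : is_deriv_on a b c2 s (c2' s) by case: C2 => /(_ 0%N s k0 sab).
  have := is_deriv_onB (is_deriv_on_mulmx (is_deriv_on_cst a b h s) d1) d2.
  by rewrite mul0mx add0r => /is_deriv_on_mxP/(_ i ord0).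
have := abs_continuous_growth phac dph mpsi tab.
rewrite incr.
rewrite -lee_fin => /le_trans; apply.
have psiw s : s \in `[a, b] -> `|psi s| <= `|w s| + n%:R * eta * M.
  move=> sab; rewrite /w colE.
  have -> : psi s = (g s *m c1' s - c2' s) i ord0 - ((g s - h) *m c1' s) i ord0.
    by rewrite mulmxBl /psi !mxE; ring.
  apply: (le_trans (ler_normB _ _)); rewrite lerD2l -mulrA.
  apply: norm_mulmx_entry => // l; first by rewrite !mxE gh.
  exact: le_trans (norm_mx_entry _ _ _) (c1M s sab).
apply: (@le_trans _ _ (\int[mu]_(s in `[a, b])
    ((`|w s|)%:E + (n%:R * eta * M)%:E))%E).
  apply: ge0_le_integral => //.
  - by apply/measurable_EFinP; exact: measurableT_comp.
  - by apply: emeasurable_funD => //; apply/measurable_EFinP;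
    exact: measurableT_comp.
have K0 : 0 <= n%:R * eta * M by rewrite !mulr_ge0.
rewrite ge0_integralD//; last first.
  by apply/measurable_EFinP; exact: measurableT_comp.
rewrite EFinD leeD//; last first.
  rewrite integral_cst//= lebesgue_measure_itv/=.
  case: ifP => _; first exact: lexx.
  by rewrite mule0 lee_fin mulr_ge0// subr_ge0.
have w2 : (\int[mu]_(s in `[a, b]) (w s ^+ 2)%:E <=
    ((lam ord0 j0)^-1 * (2 * e ^+ 2))%:E)%E.
  have li0 : 0 <= (lam ord0 j0)^-1 by rewrite invr_ge0 ltW.
  have mW : measurable_fun `[a, b] (fun s =>
      (weighted_sq lam (g s *m jet a b k c1 s - jet a b k c2 s))%:E).
    apply/measurable_EFinP; apply: measurable_weighted_sq => i' j'.
    exact: jet_diff_measurable Hg.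
  have W0 s : 0 <= weighted_sq lam (g s *m jet a b k c1 s - jet a b k c2 s).
    by apply: weighted_sq_ge0 => j; exact: ltW.
  rewrite EFinM; apply: (@le_trans _ _ ((lam ord0 j0)^-1%:E *
     \int[mu]_(s in `[a, b])
     (weighted_sq lam (g s *m jet a b k c1 s - jet a b k c2 s))%:E)%E); last first.
    by rewrite lee_wpmul2l// lee_fin.
  rewrite -ge0_integralZl//; [|by move=> s _; rewrite lee_fin W0].
  apply: ge0_le_integral => //.
  - by move=> s _; rewrite lee_fin sqr_ge0.
  - by apply/measurable_EFinP; exact: measurable_funX.
  - exact: measurable_funeM.
  - move=> s _; rewrite -EFinM lee_fin mulrC ler_pdivlMr// mulrC.
    by apply: weighted_sq_entry => j; exact: ltW.
apply: (le_trans (L1_le_L2 ab e0 mw w2)).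
rewrite -EFinM -EFinD lee_fin lerD2l.
have -> : e^-1 / 2 * ((lam ord0 j0)^-1 * (2 * e ^+ 2)) = e / lam ord0 j0.
  by field; rewrite !gt_eqF.
exact: lexx.
Qed.
End Vanishing.

(** * Pairs of curves at distance zero *)

Section Rigidity.
Context {R : realType}.
Local Notation mu := (@lebesgue_measure R).

Lemma min_energy0_near_rotation n k (a b : R) (lam : 'rV[R]_k)
    (c1 c2 : R -> 'cV[R]_n) :
  (0 < k)%N -> a < b -> (forall j, 0 < lam ord0 j) ->
  Ck a b k c1 -> Ck a b k c2 -> min_energy a b lam c1 c2 = 0%E ->
  exists2 C, 0 <= C & forall e, 0 < e ->
  exists2 h : 'M[R]_n, orthogonal_group h & {in `[a, b], forall t i,
    `|(h *m (c1 t - c1 a) - (c2 t - c2 a)) i ord0| <= C * e}.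
Proof.
move=> k0 ab lam0 C1 C2 D0; have ab' := ltW ab.
have [M M0 [c1M _]] := Ck_abs_continuous k0 C1.
pose j0 := Ordinal k0; pose K := (b - a) / 2 + 1.
have ba0 : 0 <= b - a by rewrite subr_ge0.
have K0 : 0 <= K by rewrite addr_ge0// divr_ge0.
exists ((b - a) / 2 + (lam ord0 j0)^-1 + n%:R * K * M * (b - a)).
  by rewrite !addr_ge0 ?divr_ge0 ?invr_ge0 ?mulr_ge0// ltW.
move=> e e0; have e2 : 0 < e ^+ 2 by rewrite exprn_gt0.
have [g [dg [Hg]]] := min_energy_approx lam0 C1 C2 e2.
rewrite D0 add0e energyE// lee_pdivrMl// -EFinM => Ie.
have lam0' j : 0 <= lam ord0 j by exact: ltW.
have mE : measurable_fun `[a, b]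
    (fun s => (energy_density a b lam c1 c2 g dg s)%:E).
  by apply/measurable_EFinP; exact: energy_density_measurable.
have Id : (\int[mu]_(s in `[a, b]) (frobenius_sq (dg s))%:E <= (2 * e ^+ 2)%:E)%E.
  apply: le_trans Ie; apply: ge0_le_integral => //.
  - by move=> s _; rewrite lee_fin frobenius_sq_ge0.
  - apply/measurable_EFinP; apply: measurable_weighted_sq => i j.
    exact: H1_curve_deriv_measurable Hg.
  - by move=> s _; rewrite lee_fin /energy_density lerDr weighted_sq_ge0.
have Iw : (\int[mu]_(s in `[a, b])
    (weighted_sq lam (g s *m jet a b k c1 s - jet a b k c2 s))%:E <=
      (2 * e ^+ 2)%:E)%E.
  apply: le_trans Ie; apply: ge0_le_integral => //.
  - by move=> s _; rewrite lee_fin weighted_sq_ge0.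
  - apply/measurable_EFinP; apply: measurable_weighted_sq => i j.
    exact: jet_diff_measurable Hg.
  - by move=> s _; rewrite lee_fin /energy_density lerDl frobenius_sq_ge0.
have aab : a \in `[a, b] by rewrite in_itv/= lexx.
exists (g a); first by case: Hg => og _ _ _; exact: og.
have oga : orthogonal_group (g a) by case: Hg => og _ _ _; exact: og.
have osc := rotation_oscillation ab' e0 Hg Id.
have eK0 : 0 <= e * K by rewrite mulr_ge0// ltW.
move=> t tab i.
have := near_rotation_bound (j0 := j0) ab' e0 eK0 M0 erefl lam0 C1 C2 c1M Hg
  oga osc Iw tab i.
move=> /le_trans; apply.
suff -> : e / 2 * (b - a) + e / lam ord0 j0 + n%:R * (e * K) * M * (b - a) =
  ((b - a) / 2 + (lam ord0 j0)^-1 + n%:R * K * M * (b - a)) * e by [].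
by move: (lam ord0 j0)^-1 => l; field.
Qed.

(** Compactness of [O(n)], phrased so that any closed condition that holds
    asymptotically along the sequence is inherited by the limit point; this
    includes orthogonality.  Matrices are read as row vectors to be in reach of
    the compactness of products of segments. *)
Lemma rotation_cluster n (h_ : nat -> 'M[R]_n) :
  (forall m, orthogonal_group (h_ m)) ->
  exists h : 'M[R]_n, forall (f : 'rV[R]_(n * n) -> R) (y : R)
      (u : nat -> R), continuous f -> u @ \oo --> 0 ->
    (forall m, `|f (mxvec (h_ m)) - y| <= u m) -> f (mxvec h) = y.
Proof.
move=> oh.
have cK : compact [set v : 'rV[R]_(n * n) |
    forall l, (`[-1, 1]%classic : set R) (v ord0 l)].
  apply: (@rV_compact R _ (fun=> `[-1, 1]%classic)) => _.
  exact: segment_compact.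
have hK m l : (`[-1, 1]%classic : set R) (mxvec (h_ m) ord0 l).
  case/mxvec_indexP: l => i j; rewrite mxvecE /= in_itv/= -ler_norml.
  exact: orthogonal_group_entry.
have KF : (mxvec (h_ m) @[m --> \oo])
    [set v | forall l, (`[-1, 1]%classic : set R) (v ord0 l)].
  by exists 0%N => // m _ l; exact: hK.
have [w [_ wcl]] := cK (mxvec (h_ m) @[m --> \oo]) _ KF.
exists (vec_mx w) => f y u cf u0 fu; rewrite vec_mxK.
apply/eqP; rewrite -subr_eq0 -normr_le0; apply/ler_addgt0Pr => e e0; rewrite add0r.
have e2 : 0 < e / 2 by rewrite divr_gt0.
have /cvgrPdist_lt/(_ _ e2) [N _ HN] := u0.
have Bw : \forall v \near w, `|f w - f v| < e / 2.
  by have /cvgrPdist_lt/(_ _ e2) := cf w.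
have AF : ((fun m => mxvec (h_ m)) @ \oo)
    [set mxvec (h_ m) | m in [set m | (N <= m)%N]].
  by exists N => // m /= Nm; exists m.
have [_ [[m /= Nm <-] Hm]] := wcl _ _ AF Bw.
have := HN m Nm; rewrite /= sub0r normrN => um.
have := le_trans (fu m) (ler_norm _).
have -> : f w - y = (f w - f (mxvec (h_ m))) + (f (mxvec (h_ m)) - y).
  by rewrite addrA subrK.
move=> Hf; apply: (le_trans (ler_normD _ _)); move: Hm Hf um;
  rewrite /= => Hm Hf um.
by lra.
Qed.

Lemma cvg_sum_seq (T I : Type) (F : set_system T) (FF : Filter F) (r : seq I)
    (f : I -> T -> R) (x : I -> R) :
  (forall i, f i @ F --> x i) ->
  (fun t => \sum_(i <- r) f i t) @ F --> \sum_(i <- r) x i.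
Proof.
move=> fx; elim: r => [|i r IH].
  by rewrite big_nil; under eq_fun do rewrite big_nil; exact: cvg_cst.
by rewrite big_cons; under eq_fun do rewrite big_cons; exact: cvgD.
Qed.

Lemma continuous_mulmx_entry (T : topologicalType) m n p (A : T -> 'M[R]_(m, n))
    (B : T -> 'M[R]_(n, p)) :
  (forall i j, continuous (fun t => A t i j)) ->
  (forall i j, continuous (fun t => B t i j)) ->
  forall i j, continuous (fun t => (A t *m B t) i j).
Proof.
move=> cA cB i j t; rewrite /continuous_at mxE; under eq_fun do rewrite mxE.
by apply: cvg_sum_seq => l; apply: cvgM; [exact: cA|exact: cB].
Qed.

Lemma min_energy0_orbit n k (a b : R) (lam : 'rV[R]_k)
    (c1 c2 : R -> 'cV[R]_n) :
  (0 < k)%N -> a < b -> (forall j, 0 < lam ord0 j) ->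
  Ck a b k c1 -> Ck a b k c2 -> min_energy a b lam c1 c2 = 0%E ->
  euclidean_orbit a b k c1 c2.
Proof.
move=> k0 ab lam0 C1 C2 D0.
have [C C0 near] := min_energy0_near_rotation k0 ab lam0 C1 C2 D0.
have /choice[h_ hP] (m : nat) : exists h : 'M[R]_n, orthogonal_group h /\
    {in `[a, b], forall t i, `|(h *m (c1 t - c1 a) - (c2 t - c2 a)) i ord0|
      <= C * harmonic m}.
  by have [h oh hm] := near (harmonic m) (harmonic_gt0 m); exists h.
have [h hlim] := rotation_cluster (fun m => (hP m).1).
have cvec i j : continuous (fun v : 'rV[R]_(n * n) => vec_mx v i j).
  under eq_fun do rewrite mxE; exact: coord_continuous.
split => //; exists h.
  apply/matrixP => i j.
  have cf : continuous (fun v : 'rV[R]_(n * n) =>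
      ((vec_mx v)^T *m vec_mx v) i j).
    apply: continuous_mulmx_entry; last exact: cvec.
    by move=> i' j'; under eq_fun do rewrite mxE; exact: cvec.
  have := hlim _ ((1%:M : 'M[R]_n) i j) (fun=> 0) cf (cvg_cst _).
  rewrite mxvecK; apply => m.
  by rewrite mxvecK (hP m).1 subrr normr0.
exists (c2 a - h *m c1 a) => t tab.
suff H : h *m (c1 t - c1 a) = c2 t - c2 a.
  by rewrite addrC -addrA [- _ + _]addrC -mulmxBr H addrC subrK.
apply/matrixP => i j; rewrite ord1.
have cf : continuous (fun v : 'rV[R]_(n * n) =>
    (vec_mx v *m (c1 t - c1 a)) i ord0).
  apply: continuous_mulmx_entry => i' j'; first exact: cvec.
  exact: cst_continuous.
have u0 : (fun m => C * harmonic m) @ \oo --> 0.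
  rewrite -[X in _ --> X](mulr0 C); apply: cvgMr; exact: cvg_harmonic.
have := hlim _ ((c2 t - c2 a) i ord0) _ cf u0; rewrite mxvecK; apply => m.
by rewrite mxvecK; have := (hP m).2 t tab i; rewrite [X in `|X|]mxE [X in _ + X]mxE.
Qed.

Lemma euclidean_orbit_refl n k (a b : R) (c : R -> 'cV[R]_n) :
  Ck a b k c -> euclidean_orbit a b k c c.
Proof.
move=> cC; split=> //; exists 1%:M; first exact: orthogonal_group1.
by exists 0 => s _; rewrite mul1mx addr0.
Qed.

Lemma euclidean_orbit_sub n k (a b : R) (c c' : R -> 'cV[R]_n) :
  euclidean_orbit a b k c c' ->
  euclidean_orbit a b k c' `<=` euclidean_orbit a b k c.
Proof.
move=> [_ [g og [x c'E]]] c'' [C'' [h oh [y c''E]]]; split=> //.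
exists (h *m g); first exact: orthogonal_group_mul.
exists (h *m x + y) => s sab.
by rewrite c''E// c'E// mulmxDr mulmxA addrA.
Qed.

Lemma euclidean_orbit_sym n k (a b : R) (c c' : R -> 'cV[R]_n) :
  Ck a b k c -> euclidean_orbit a b k c c' -> euclidean_orbit a b k c' c.
Proof.
move=> cC [_ [g og [x c'E]]]; split=> //.
exists g^T; first exact: orthogonal_group_tr.
exists (- (g^T *m x)) => s sab.
by rewrite c'E// mulmxDr mulmxA og mul1mx addrK.
Qed.

Lemma euclidean_orbit_eq n k (a b : R) (c c' : R -> 'cV[R]_n) :
  Ck a b k c -> euclidean_orbit a b k c c' ->
  euclidean_orbit a b k c = euclidean_orbit a b k c'.
Proof.
move=> cC oc; apply/seteqP; split; apply: euclidean_orbit_sub => //.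
exact: euclidean_orbit_sym.
Qed.

Definition orbit_repr n k (a b : R) (A : set (R -> 'cV[R]_n)) : R -> 'cV[R]_n :=
  xget (fun=> 0) [set c | Ck a b k c /\ euclidean_orbit a b k c = A].

Lemma orbit_reprP n k (a b : R) (A : set (R -> 'cV[R]_n)) :
  curves_mod_euclidean a b k A ->
  Ck a b k (orbit_repr k a b A) /\ euclidean_orbit a b k (orbit_repr k a b A) = A.
Proof.
move=> [c cC cA].
exact: (@xgetPex _ _ [set c | Ck a b k c /\ euclidean_orbit a b k c = A]
  (ex_intro _ c (conj cC cA))).
Qed.

Lemma euclidean_orbit_repr n k (a b : R) (c : R -> 'cV[R]_n) : Ck a b k c ->
  euclidean_orbit a b k c (orbit_repr k a b (euclidean_orbit a b k c)).
Proof.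
move=> cC; have cm : curves_mod_euclidean a b k (euclidean_orbit a b k c).
  by exists c.
have [rC rE] := orbit_reprP cm.
by rewrite -[X in X _]rE; exact: euclidean_orbit_refl.
Qed.
End Rigidity.

(** * The distance on curves modulo rigid motions *)

Theorem theorem3p2 (R : realType) (n k : nat) (hn : (1 <= n)%N)
    (hk : (1 <= k)%N) (a b : R) (hab : a < b) (lam : 'rV[R]_k)
    (hlam : forall i, 0 < lam ord0 i) :
  exists d : set (R -> 'cV[R]_n) -> set (R -> 'cV[R]_n) -> R,
    (forall c1 c2 : R -> 'cV[R]_n, Ck a b k c1 -> Ck a b k c2 ->
       (d (euclidean_orbit a b k c1) (euclidean_orbit a b k c2))%:E
       = min_energy a b lam c1 c2) /\
    (forall A B C : set (R -> 'cV[R]_n),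
       curves_mod_euclidean a b k A ->
       curves_mod_euclidean a b k B ->
       curves_mod_euclidean a b k C ->
       [/\ 0 <= d A B,
           d A B = d B A,
           d A B = 0 <-> A = B &
           Num.sqrt (d A C) <= Num.sqrt (d A B) + Num.sqrt (d B C)]).
Proof.
exists (fun A B =>
  fine (min_energy a b lam (orbit_repr k a b A) (orbit_repr k a b B))).
split=> [c1 c2 C1 C2|A B C].
  have orb1 := euclidean_orbit_repr C1; have orb2 := euclidean_orbit_repr C2.
  have r2 := orb2.1.
  have E : min_energy a b lam (orbit_repr k a b (euclidean_orbit a b k c1))
      (orbit_repr k a b (euclidean_orbit a b k c2)) = min_energy a b lam c1 c2.
    rewrite (min_energy_orbit hab hlam C1 r2 orb1) (min_energy_sym _ _ hlam).
    by rewrite (min_energy_orbit hab hlam C2 C1 orb2) (min_energy_sym _ _ hlam).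
  rewrite E; apply: fineK; exact: (min_energy_fin hlam C1 C2).
move=> /orbit_reprP[A1 AE] /orbit_reprP[B1 BE] /orbit_reprP[C1 _].
split.
- by apply: fine_ge0; exact: min_energy_ge0.
- exact: (congr1 fine (min_energy_sym _ _ hlam _ _)).
- split=> [d0|<-].
    rewrite -AE -BE; apply: euclidean_orbit_eq => //.
    apply: (min_energy0_orbit hk hab hlam) => //.
    by rewrite -(fineK (min_energy_fin hlam A1 B1)) d0.
  exact: (congr1 fine (min_energy_rigid hab hlam A1 (euclidean_orbit_refl A1))).
- exact: sqrt_min_energy_triangle.
Qed.
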